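(* Let $\alpha>1$, and let $\nu$ be a finite positive Borel measure on $(1/2,\infty)$. Define $$\varrho(n)=d_\alpha(n)\int_{1/2}^\infty n^{-s}\,d\nu(s),\qquad n\ge1,$$ and let $\mathcal H_{\varrho,d_\alpha}$ be the weighted multiplicative Hankel form induced by $\varrho$ (see context). Then the following conditions are equivalent. (1) The form $\mathcal H_{\varrho,d_\alpha}$ is a bounded bilinear form on $\ell^2_{d_\alpha}(\mathbb N)$. (2) There is a constant $C>0$ such that $\nu\bigl((1/2,1/2+\varepsilon]\bigr)\le C\varepsilon^\alpha$ as $\varepsilon\to0^+$ (i.e. for all sufficiently small $\varepsilon>0$). (3) There is a constant $C>0$ such that $$\varrho(n)\le C\frac{d_\alpha(n)}{\sqrt n\,(\log n)^\alpha},\qquad n\ge2.$$ (4) The operator $$(\mathcal K_{\alpha,\nu}f)(t)=\int_{1/2}^\infty\zeta(s+t)^\alpha f(s)\,d\nu(s),\qquad t>\tfrac12,$$ is bounded on $L^2(\nu)$.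
   Context: For $\alpha>1$ the coefficients $d_\alpha(n)>0$ are defined by $\zeta(s)^\alpha=\sum_{n\ge1}d_\alpha(n)n^{-s}$, $\operatorname{Re}s>1$. The space $\ell^2_{d_\alpha}(\mathbb N)$ consists of complex sequences $a=(a_n)_{n\ge1}$ with $\|a\|_{\ell^2_{d_\alpha}}^2:=\sum_{n\ge1}|a_n|^2/d_\alpha(n)<\infty$. For a complex sequence $\varrho=(\varrho(n))_{n\ge1}$, the weighted multiplicative Hankel form is defined on finitely supported sequences by $$\mathcal H_{\varrho,d_\alpha}(a,b)=\sum_{m,n\ge1}a_mb_n\frac{\varrho(mn)}{d_\alpha(mn)},$$ and it is called bounded if there is $C$ with $|\mathcal H_{\varrho,d_\alpha}(a,b)|\le C\|a\|_{\ell^2_{d_\alpha}}\|b\|_{\ell^2_{d_\alpha}}$ for all finitely supported $a,b$. *)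

(* Defs.v *)
From HB Require Import structures.
From mathcomp Require Export all_boot all_order all_algebra.
From mathcomp Require Export all_classical all_reals all_analysis.
From mathcomp Require Export complex.

Set Implicit Arguments.
Unset Strict Implicit.
Unset Printing Implicit Defensive.

Import Order.TTheory GRing.Theory Num.Theory.
Import numFieldNormedType.Exports.

Local Open Scope classical_set_scope.
Local Open Scope ring_scope.
Local Open Scope complex_scope.

Notation cabs := ComplexField.Normc.normc.

(** Sequences indexed by n >= 1 are functions on nat whose value at 0 is never
    used. *)

Section ZetaPowers.
Context {R : realType}.

Definition cexp (z : R[i]) : R[i] :=
  (expR (complex.Re z))%:C * (cos (complex.Im z) +i* sin (complex.Im z)).

(* n ^ s for n >= 1 *)
Definition cnatpow (n : nat) (s : R[i]) : R[i] := cexp (s * (ln n%:R)%:C).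

(* Partial sums a_1 1^{-s} + ... + a_N N^{-s}; R[i]^o is R[i] with its norm
   topology. *)
Definition dirichlet_series (a : nat -> R[i]) (s : R[i]) : nat -> R[i]^o :=
  series (fun n => a n.+1 * cnatpow n.+1 (- s) : R[i]^o).

(* Meaningful for Re s > 1 only. *)
Definition zeta (s : R[i]) : R[i] := limn (dirichlet_series (fun=> 1) s).

(* The branch of log zeta on Re s > 1 that is real on the real half-line. The
   principal logarithm would not do: arg zeta is unbounded on Re s > 1. *)
Definition is_log_zeta (L : R[i] -> R[i]) : Prop :=
  [/\ forall s : R[i]^o, 1 < complex.Re s ->
        {for s, continuous (L : R[i]^o -> R[i]^o)},
      forall s : R[i], 1 < complex.Re s -> cexp (L s) = zeta s
    & forall x : R, 1 < x -> complex.Im (L x%:C) = 0].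

(* d = d_alpha, the (positive) Dirichlet coefficients of
   zeta^alpha = exp (alpha log zeta); uniqueness of Dirichlet coefficients
   makes d n unique for n >= 1. *)
Definition zeta_power_coeffs (alpha : R) (d : nat -> R) : Prop :=
  (forall n, (1 <= n)%N -> 0 < d n) /\
  exists2 L, is_log_zeta L &
    forall s : R[i], 1 < complex.Re s ->
      dirichlet_series (fun n => (d n)%:C) s @ \oo
        --> (cexp (alpha%:C * L s) : R[i]^o).

(* zeta(x)^alpha for real x > 1, where zeta(x) is real and positive. *)
Definition zeta_powR (alpha x : R) : R := (complex.Re (zeta x%:C)) `^ alpha.

End ZetaPowers.

Section HankelForm.
Context {R : realType}.

Definition finitely_supported (a : nat -> R[i]) : Prop :=
  finite_set [set n | a n != 0].

(* The norm of l^2_d for sequences belonging to that space. *)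
Definition l2norm (d : nat -> R) (a : nat -> R[i]) : R :=
  Num.sqrt (fine (\sum_(1 <= n <oo) (cabs (a n) ^+ 2 / d n)%:E)%E).

(* Sums over an infinite set, meant for finitely supported a and b only. *)
Definition hankel_form (rho : nat -> R[i]) (d : nat -> R)
    (a b : nat -> R[i]) : R[i] :=
  \sum_(m \in [set m | (1 <= m)%N]) \sum_(n \in [set n | (1 <= n)%N])
    a m * b n * (rho (m * n)%N / (d (m * n)%N)%:C).

Definition hankel_bounded (rho : nat -> R[i]) (d : nat -> R) : Prop :=
  exists C : R, forall a b : nat -> R[i],
    finitely_supported a -> finitely_supported b ->
    cabs (hankel_form rho d a b) <= C * l2norm d a * l2norm d b.

End HankelForm.

Section MeasureSide.
Context {R : realType}.

Definition half_line : set R := `]2^-1, +oo[.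

(* Finite Borel measures on (1/2, oo) are identified with the finite Borel
   measures on R that vanish off (1/2, oo). *)
Definition measure_on_half_line (nu : {finite_measure set R -> \bar R}) : Prop :=
  nu (~` half_line) = 0%E.

Definition varrho (d : nat -> R) (nu : {finite_measure set R -> \bar R})
    (n : nat) : R :=
  d n * \int[nu]_(s in half_line) (n%:R `^ (- s)).

Definition cintegral (nu : {finite_measure set R -> \bar R}) (f : R -> R[i])
    : R[i] :=
  (\int[nu]_(s in half_line) complex.Re (f s)) +i*
  (\int[nu]_(s in half_line) complex.Im (f s)).

(* Complex L^2(nu), at the level of representatives. *)
Definition L2sqnorm (nu : {finite_measure set R -> \bar R}) (f : R -> R[i])
    : \bar R :=
  (\int[nu]_(s in half_line) (cabs (f s) ^+ 2)%:E)%E.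

Definition inL2 (nu : {finite_measure set R -> \bar R}) (f : R -> R[i])
    : Prop :=
  [/\ measurable_fun half_line (fun s => complex.Re (f s)),
      measurable_fun half_line (fun s => complex.Im (f s))
    & (L2sqnorm nu f < +oo)%E].

Definition L2norm (nu : {finite_measure set R -> \bar R}) (f : R -> R[i]) : R :=
  Num.sqrt (fine (L2sqnorm nu f)).

(* For f in L^2(nu) and t > 1/2 the integrand is nu-integrable, since
   s |-> zeta(s+t)^alpha is bounded on (1/2, oo) and nu is finite. *)
Definition Kop (alpha : R) (nu : {finite_measure set R -> \bar R})
    (f : R -> R[i]) (t : R) : R[i] :=
  cintegral nu (fun s => (zeta_powR alpha (s + t))%:C * f s).

Definition L2_bounded (nu : {finite_measure set R -> \bar R})
    (T : (R -> R[i]) -> (R -> R[i])) : Prop :=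
  exists C : R, forall f : R -> R[i],
    inL2 nu f -> inL2 nu (T f) /\ L2norm nu (T f) <= C * L2norm nu f.

End MeasureSide.

(* Main.v *)
(* Put F_x(s) = sum x_n n^(-s).  The Hankel form at (a, b) is the integral of
   F_a F_b, so it is bounded iff the embedding x |-> F_x maps l^2_d boundedly
   into L^2(nu).  The adjoint of the embedding sends u to the sequence
   d_n * (integral of n^(-s) u(s) dnu(s)), and the embedding composed with its
   adjoint is the operator K, because zeta(s + t)^alpha = sum d_n n^(-s) n^(-t).
   Hence (4) implies (1).

   (1) => (2).  Test the embedding on x_n = d_n n^(-1/2 - e): the squared norm
   of x and F_x(1/2 + e) are both zeta(1 + 2e)^alpha >= (2e)^(-alpha).

   (2) <=> (3).  As n^(-s) = n^(-1/2) exp(- (s - 1/2) log n), the moments of nu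
   are values of a Laplace transform; nu near 1/2 is recovered from the moment
   with n close to exp(1/e).

   (2) => (4).  With tau(s) = min(s - 1/2, 1), zeta(s + t)^alpha is at most
   3^alpha (tau(s) + tau(t))^(-alpha), while {tau <= r} has measure O(r^alpha).
   Cutting the half-line at the dyadic levels of tau shows that
   tau^(-alpha/2) is a weight for Schur's test. *)
Require Import Defs.
From mathcomp Require Import measurable_realfun ring lra zify.

Set Implicit Arguments.
Unset Strict Implicit.
Unset Printing Implicit Defensive.

Import Order.TTheory GRing.Theory Num.Theory.
Import numFieldNormedType.Exports.
Local Open Scope classical_set_scope.
Local Open Scope ring_scope.
Local Open Scope complex_scope.

Section PowR.
Context {R : realType}.
Implicit Types a b x y e : R.

Lemma gt0_powRD x a b : 0 < x -> x `^ (a + b) = x `^ a * x `^ b.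
Proof. by move=> x0; rewrite powRD // lt0r_neq0 ?implybT. Qed.

Lemma powRN_inv x b : 0 <= x -> x `^ (- b) = x^-1 `^ b.
Proof. by move=> x0; rewrite -powR_inv1 // -powRrM mulN1r. Qed.

Lemma ge0_ger_powRN b x y : 0 <= b -> 0 < x -> x <= y ->
  y `^ (- b) <= x `^ (- b).
Proof.
move=> b0 x0 xy; have y0 := lt_le_trans x0 xy.
rewrite !powRN_inv ?(ltW x0) ?(ltW y0) //.
by apply: (ge0_ler_powR b0); rewrite ?nnegrE ?invr_ge0 ?lef_pV2 ?posrE // ltW.
Qed.

Lemma powRN_tangent e x y : 0 <= e -> 0 < x -> 0 < y ->
  x `^ (- e) - e * x `^ (- (1 + e)) * (y - x) <= y `^ (- e).
Proof.
move=> e0 x0 y0.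
have yxE : y = x * (y / x) by field; rewrite gt_eqF.
have bernoulli : 1 - e * (y / x - 1) <= (y / x) `^ (- e).
  rewrite /powR gt_eqF ?divr_gt0 // mulNr; apply: le_trans (expR_ge1Dx _).
  rewrite lerD2l lerN2 ler_wpM2l // -{1}(subrKC 1 (y / x)) le_ln1Dx //.
  by rewrite ltrBrDl subrr divr_gt0.
rewrite [in leRHS]yxE powRM ?divr_ge0 ?(ltW x0) ?(ltW y0) //.
apply: le_trans (ler_wpM2l (powR_ge0 x (- e)) bernoulli).
rewrite opprD gt0_powRD // powR_inv1 ?(ltW x0) // le_eqVlt.
by apply/orP; left; apply/eqP; field; rewrite gt_eqF.
Qed.

Lemma exprn_powR x b n : 0 <= x -> (x ^+ n) `^ b = (x `^ b) ^+ n.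
Proof. by move=> x0; rewrite -powR_mulrn // powRAC powR_mulrn ?powR_ge0. Qed.

Lemma powR_lt1 x a : 1 < x -> a < 0 -> x `^ a < 1.
Proof.
move=> x1 a0; have x0 := lt_trans ltr01 x1.
by rewrite /powR gt_eqF // -expR0 ltr_expR nmulr_rlt0 // ln_gt0.
Qed.

Lemma powR_le_expR a x : 0 < a -> 0 <= x -> x `^ a <= a `^ a * expR x.
Proof.
move=> a0 x0.
have -> : expR x = expR (x / a) `^ a.
  by rewrite /powR gt_eqF ?expR_gt0 // expRK mulrC divfK ?gt_eqF.
rewrite -powRM ?expR_ge0 ?(ltW a0) //.
apply: ge0_ler_powR; rewrite ?nnegrE ?mulr_ge0 ?expR_ge0 ?(ltW a0) //.
rewrite mulrC -ler_pdivrMr //; apply: le_trans (expR_ge1Dx _).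
by rewrite lerDr.
Qed.

Lemma dyadic_bracket x y : 0 < x -> x <= y ->
  exists k : nat, x * 2 ^+ k <= y < x * 2 ^+ k.+1.
Proof.
move=> x0 xy.
have unbounded : exists k, y < x * 2 ^+ k.+1.
  exists (Num.truncn (y / x)); rewrite mulrC -ltr_pdivrMr //.
  by apply: lt_trans (truncnS_gt _) _; rewrite -natrX ltr_nat ltn_expl.
case: (ex_minnP unbounded) => k yk kmin; exists k; rewrite yk andbT.
case: k yk kmin => [_ _|k _ kmin]; first by rewrite expr0 mulr1.
by rewrite leNgt; apply/negP => /kmin; rewrite ltnn.
Qed.

Lemma exists_nat_near_expR_inv e : 0 < e -> e < 1 -> exists n : nat,
  [/\ (2 <= n)%N, n%:R `^ e <= expR 1 :> R & (2 * e)^-1 <= ln n%:R :> R].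
Proof.
move=> e0 e1; pose n := Num.truncn (expR e^-1 : R); exists n.
have einv : 1 < e^-1 by rewrite invf_gt1.
have n2 : (2 <= n)%N.
  by rewrite truncn_ge_nat ?expR_ge0 //; apply: le_trans (expR_ge1Dx _); lra.
have n_le : n%:R <= expR e^-1 :> R by rewrite truncn_le expR_ge0.
have n_gt : expR e^-1 < n.+1%:R :> R by exact: truncnS_gt.
have n0 : 0 < n%:R :> R by rewrite ltr0n ltnW.
split=> //.
- have -> : expR 1 = expR e^-1 `^ e :> R.
    by rewrite /powR gt_eqF ?expR_gt0 // expRK mulfV ?gt_eqF.
  by apply: ge0_ler_powR; rewrite ?nnegrE ?expR_ge0 ?(ltW e0) ?(ltW n0).
- have : expR e^-1 <= n%:R ^+ 2 :> R.
    by apply: le_trans (ltW n_gt) _; rewrite -natrX ler_nat; nia.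
  rewrite -ler_ln ?posrE ?expR_gt0 ?exprn_gt0 // expRK lnXn // mulr2n invfM.
  by lra.
Qed.

End PowR.

Section RealDirichletSeries.
Context {R : realType}.
Implicit Types (x y e : R) (a : nat -> R) (N n : nat).

Lemma cvg_complex_Re {T : Type} {F : set_system T} {FF : Filter F}
    (u : T -> R[i]^o) (l : R[i]^o) :
  u @ F --> l -> (fun t => complex.Re (u t)) @ F --> complex.Re l.
Proof.
move=> /cvgrPdist_lt ul; apply/cvgrPdist_lt => e e0.
have ec0 : 0 < (e%:C : R[i]) by rewrite ltcR.
near=> t; have ut : `|l - u t| < e%:C by near: t; exact: ul.
rewrite -ltcR; apply: le_lt_trans ut.
by have := normc_ge_Re (l - u t); case: (l) (u t) => [? ?] [].
Unshelve. all: by end_near. Qed.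

Lemma cvg_real_complex {T : Type} {F : set_system T} {FF : Filter F}
    (u : T -> R) (l : R) :
  u @ F --> l -> (fun t => (u t)%:C : R[i]^o) @ F --> (l%:C : R[i]^o).
Proof.
move=> /cvgrPdist_lt ul; apply/cvgrPdist_lt => e e0.
have /complex_realP[r er] : e \is Num.real by exact: gtr0_real.
have r0 : 0 < r by rewrite -ltcR -er.
near=> t; rewrite -rmorphB /= normc_def /= expr0n addr0 sqrtr_sqr er ltcR.
by near: t; exact: ul.
Unshelve. all: by end_near. Qed.

Lemma cexp_real x : cexp x%:C = (expR x)%:C :> R[i].
Proof. by rewrite /cexp /= cos0 sin0 mulr1. Qed.

Lemma cnatpow_real n x :
  cnatpow n.+1 (- x%:C) = (n.+1%:R `^ (- x))%:C :> R[i].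
Proof. by rewrite /cnatpow -rmorphN -rmorphM cexp_real /powR gt_eqF. Qed.

Definition dirichlet_poly a N x : R :=
  \sum_(0 <= n < N) a n.+1 * n.+1%:R `^ (- x).

Lemma dirichlet_polyS a N x :
  dirichlet_poly a N.+1 x = dirichlet_poly a N x + a N.+1 * N.+1%:R `^ (- x).
Proof. by rewrite /dirichlet_poly big_nat_recr. Qed.

Lemma dirichlet_series_real a x :
  dirichlet_series (fun n => (a n)%:C) x%:C =
  fun N => (dirichlet_poly a N x)%:C.
Proof.
apply/funext => N.
rewrite /dirichlet_series /series /dirichlet_poly /= rmorph_sum /=.
by apply: eq_bigr => n _; rewrite cnatpow_real rmorphM.
Qed.

Lemma dirichlet_poly_ge0 a N x : (forall n, (1 <= n)%N -> 0 <= a n) ->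
  0 <= dirichlet_poly a N x.
Proof.
by move=> a0; apply: sumr_ge0 => n _; rewrite mulr_ge0 ?a0 ?powR_ge0.
Qed.

Lemma dirichlet_polyD a N x y : dirichlet_poly a N (x + y) =
  dirichlet_poly (fun n => a n * n%:R `^ (- y)) N x.
Proof.
by apply: eq_bigr => n _; rewrite opprD gt0_powRD // [_ `^ _ * _]mulrC mulrA.
Qed.

Lemma ler_dirichlet_poly a N x y : (forall n, (1 <= n)%N -> 0 <= a n) ->
  x <= y -> dirichlet_poly a N y <= dirichlet_poly a N x.
Proof.
move=> a0 xy; apply: ler_sum => n _; rewrite ler_wpM2l ?a0 //.
by rewrite ler_powR ?ler1n // lerN2.
Qed.

Lemma nondecreasing_dirichlet_poly a x : (forall n, (1 <= n)%N -> 0 <= a n) ->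
  nondecreasing_seq (dirichlet_poly a ^~ x).
Proof.
move=> a0; apply/nondecreasing_seqP => N; rewrite dirichlet_polyS.
by rewrite lerDl mulr_ge0 ?a0 ?powR_ge0.
Qed.

Lemma measurable_dirichlet_poly a N : measurable_fun setT (dirichlet_poly a N).
Proof.
apply: measurable_sum => n; apply: measurable_funM => //.
exact: measurableT_comp (measurable_powRr _) _.
Qed.

(* The integral test for the zeta series, telescoped: [x `^ (- e)] is convex. *)
Lemma dirichlet_poly1_bounds e N : 0 < e ->
  1 - N.+1%:R `^ (- e) <= e * dirichlet_poly (fun=> 1) N (1 + e) <= 1 + e.
Proof.
move=> e0; set P := dirichlet_poly _.
have succB n : n.+2%:R - n.+1%:R = 1 :> R by rewrite -natrB // subSnn.
have lower_step n : n.+1%:R `^ (- e) - e * n.+1%:R `^ (- (1 + e))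
    <= n.+2%:R `^ (- e) :> R.
  have := powRN_tangent (ltW e0) (ltr0Sn R n) (ltr0Sn R n.+1).
  by rewrite succB mulr1.
have upper_step n : n.+2%:R `^ (- e) + e * n.+2%:R `^ (- (1 + e))
    <= n.+1%:R `^ (- e) :> R.
  have := powRN_tangent (ltW e0) (ltr0Sn R n.+1) (ltr0Sn R n).
  by rewrite -[n.+1%:R - _]opprB succB mulrN1 opprK.
have upper n : e * P n.+1 (1 + e) <= 1 + e - n.+1%:R `^ (- e).
  elim: n => [|n IH].
    by rewrite /P /dirichlet_poly big_nat1 powR1; lra.
  by rewrite /P dirichlet_polyS mul1r -/P; have := upper_step n; lra.
apply/andP; split.
  elim: N => [|N IH].
    by rewrite /P /dirichlet_poly big_geq // mulr0 powR1 subrr.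
  by rewrite /P dirichlet_polyS mul1r -/P; have := lower_step N; lra.
apply: (@le_trans _ _ (e * P N.+1 (1 + e))); last first.
  by have := upper N; have := powR_ge0 N.+1%:R (- e); lra.
rewrite ler_pM2l //; exact: nondecreasing_dirichlet_poly.
Qed.

End RealDirichletSeries.

Section ZetaOnReals.
Context {R : realType}.
Implicit Types x e alpha : R.

Lemma cvg_natpowN e : 0 < e -> n.+1%:R `^ (- e) @[n --> \oo] --> (0 : R).
Proof.
move=> e0.
under eq_fun do rewrite powRN_inv //.
have [cvg_seq _] := cvg_at_rightP (fun x : R => x `^ e) 0 0.
apply: (cvg_seq (powR_cvg0 e0)).
by split; [exact: harmonic_gt0|exact: cvg_harmonic].
Qed.

Lemma dirichlet_poly1_cvg_zeta x : 1 < x ->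
  dirichlet_poly (fun=> 1) N x @[N --> \oo] --> complex.Re (zeta x%:C).
Proof.
move=> x1; pose P := dirichlet_poly (fun=> 1) ^~ x.
have e0 : 0 < x - 1 by rewrite subr_gt0.
have cvgP : cvgn P.
  apply: nondecreasing_is_cvgn; first exact: nondecreasing_dirichlet_poly.
  exists ((1 + (x - 1)) / (x - 1)) => _ [N _ <-].
  rewrite ler_pdivlMr // mulrC.
  by have /andP[_] := dirichlet_poly1_bounds N e0; rewrite subrKC.
rewrite /zeta (dirichlet_series_real (fun=> 1)).
by rewrite (cvg_lim (@norm_hausdorff _ _) (cvg_real_complex cvgP)).
Qed.

Lemma zeta_bounds e : 0 < e ->
  e^-1 <= complex.Re (zeta (1 + e)%:C) <= 1 + e^-1.
Proof.
move=> e0; have e1 : 1 < 1 + e by rewrite ltrDl.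
have cvgP : e * dirichlet_poly (fun=> 1) N (1 + e) @[N --> \oo] -->
    e * complex.Re (zeta (1 + e)%:C).
  by apply: cvgMl_tmp; exact: dirichlet_poly1_cvg_zeta.
have bounds N := dirichlet_poly1_bounds N e0.
apply/andP; split; rewrite -(ler_pM2l e0) ?mulrDr ?mulr1 mulfV ?gt_eqF //.
- have cvg1 : 1 - N.+1%:R `^ (- e) @[N --> \oo] --> (1 - 0 : R).
    by apply: cvgB; [exact: cvg_cst|exact: cvg_natpowN].
  rewrite -[leLHS]subr0; apply: ler_cvg_to cvg1 cvgP _.
  by apply: nearW => N; have /andP[] := bounds N.
- apply: ler_cvg_to cvgP (cvg_cst _) _.
  by apply: nearW => N; rewrite [leRHS]addrC; have /andP[] := bounds N.
Qed.

Lemma dirichlet_poly_cvg_zeta_powR alpha d : zeta_power_coeffs alpha d ->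
  forall x, 1 < x -> dirichlet_poly d N x @[N --> \oo] --> zeta_powR alpha x.
Proof.
move=> [_ [L [_ expL realL] cvgL]] x x1.
have := cvgL x%:C x1; rewrite dirichlet_series_real => /cvg_complex_Re.
have [l Ll] : exists l, L x%:C = l%:C.
  by case: (L x%:C) (realL x x1) => l i /= ->; exists l.
rewrite /zeta_powR -expL // Ll -rmorphM !cexp_real /=.
by rewrite [in X in _ -> X]/powR gt_eqF ?expR_gt0 // expRK.
Qed.

Lemma zeta_powR_le alpha e : 0 <= alpha -> 0 < e ->
  zeta_powR alpha (1 + e) <= (1 + e^-1) `^ alpha.
Proof.
move=> alpha0 e0; have /andP[lb ub] := zeta_bounds e0.
have inv0 : 0 <= e^-1 by rewrite invr_ge0 ltW.
by apply: ge0_ler_powR ub; rewrite ?nnegrE ?addr_ge0 // (le_trans inv0).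
Qed.

Lemma zeta_powR_ge alpha e : 0 <= alpha -> 0 < e ->
  e `^ (- alpha) <= zeta_powR alpha (1 + e).
Proof.
move=> alpha0 e0; have /andP[lb _] := zeta_bounds e0.
have inv0 : 0 <= e^-1 by rewrite invr_ge0 ltW.
rewrite powRN_inv ?(ltW e0) //.
by apply: ge0_ler_powR (lb); rewrite ?nnegrE // (le_trans _ lb).
Qed.

Lemma measurable_zeta_powR alpha :
  measurable_fun (`]1, +oo[%classic : set R) (zeta_powR alpha).
Proof.
apply: (@measurableT_comp _ _ _ _ _ _ (fun z : R => z `^ alpha)).
  exact: measurable_powR.
apply: (measurable_fun_cvg (h := dirichlet_poly (fun=> 1))) => [N|x].
  exact: measurable_funTS (measurable_dirichlet_poly _ _).
by rewrite /= in_itv /= andbT => x1; exact: dirichlet_poly1_cvg_zeta.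
Qed.

Lemma dirichlet_poly_le_zeta_powR alpha d N x : zeta_power_coeffs alpha d ->
  1 < x -> dirichlet_poly d N x <= zeta_powR alpha x.
Proof.
move=> hd x1; have cvgP := dirichlet_poly_cvg_zeta_powR hd x1.
rewrite -(cvg_lim (@Rhausdorff R) cvgP).
apply: (@nondecreasing_cvgn_le _ (dirichlet_poly d ^~ x)).
  by apply: nondecreasing_dirichlet_poly => n n1; exact/ltW/hd.1.
by apply/cvg_ex; eexists; exact: cvgP.
Qed.

End ZetaOnReals.

Section IteratedIntegrals.
Local Open Scope ereal_scope.
Context d1 d2 (T1 : measurableType d1) (T2 : measurableType d2) (R : realType).
Variables (D1 : set T1) (D2 : set T2).
Hypotheses (mD1 : measurable D1) (mD2 : measurable D2).
Implicit Type f : T1 * T2 -> \bar R.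

Lemma patch_integral_setX (mu : {measure set T2 -> \bar R}) f :
  (fun x => \int[mu]_(y in D2) f (x, y)) \_ D1 =
  fun x => \int[mu]_y (f \_ (D1 `*` D2)) (x, y).
Proof.
apply/funext => x; rewrite {1}/patch; case: ifPn => D1x.
  rewrite integral_mkcond; apply: eq_integral => y _.
  by rewrite /patch in_setX /= D1x.
by rewrite integral0_eq // => y _; rewrite /patch in_setX /= (negbTE D1x).
Qed.

Lemma measurable_integral_setX
    (mu : {sigma_finite_measure set T2 -> \bar R}) f :
  measurable_fun (D1 `*` D2) f ->
  measurable_fun D1 (fun x => \int[mu]_(y in D2) f (x, y)).
Proof.
move=> mf; pose g : T1 * T2 -> \bar R := f \_ (D1 `*` D2).
have mg : measurable_fun setT g.
  exact/(measurable_restrictT _ (measurableX mD1 mD2)).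
suff : measurable_fun setT (fun x => \int[mu]_y g (x, y)).
  by rewrite -patch_integral_setX => /(measurable_restrictT _ mD1).
have -> : (fun x => \int[mu]_y g (x, y)) =
    fun x => fubini_F mu g^\+ x - fubini_F mu g^\- x.
  apply/funext => x; rewrite integralE.
  by congr (_ - _); apply: eq_integral => y _; rewrite ?funeposE ?funenegE.
have mF := @measurable_fun_fubini_tonelli_F _ _ T1 T2 R mu.
apply: emeasurable_funB.
- exact: (mF _ (measurable_funepos mg) (funepos_ge0 g)).
- exact: (mF _ (measurable_funeneg mg) (funeneg_ge0 g)).
Qed.

End IteratedIntegrals.

Lemma measurable_integral_setX_swap d1 d2 (T1 : measurableType d1)
    (T2 : measurableType d2) (R : realType) (D1 : set T1) (D2 : set T2)
    (mu : {sigma_finite_measure set T1 -> \bar R}) (f : T1 * T2 -> \bar R) :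
  measurable D1 -> measurable D2 -> measurable_fun (D1 `*` D2) f ->
  measurable_fun D2 (fun y => \int[mu]_(x in D1) f (x, y))%E.
Proof.
move=> mD1 mD2 mf.
apply: (measurable_integral_setX mD2 mD1 mu (f := f \o unstable.swap)).
apply: measurable_comp mf _; first exact: measurableX.
  by move=> _ [[y x] [D2y D1x] <-].
exact: (measurable_funTS (@measurable_swap _ _ T2 T1)).
Qed.

Section Tonelli.
Local Open Scope ereal_scope.
Context d1 d2 (T1 : measurableType d1) (T2 : measurableType d2) (R : realType).
Variables (D1 : set T1) (D2 : set T2).
Hypotheses (mD1 : measurable D1) (mD2 : measurable D2).
Variable mu1 : {sigma_finite_measure set T1 -> \bar R}.
Variable mu2 : {sigma_finite_measure set T2 -> \bar R}.

Lemma fubini_tonelli_setX (f : T1 * T2 -> \bar R) :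
  measurable_fun (D1 `*` D2) f ->
  (forall x y, D1 x -> D2 y -> 0 <= f (x, y)) ->
  \int[mu1]_(x in D1) \int[mu2]_(y in D2) f (x, y) =
  \int[mu2]_(y in D2) \int[mu1]_(x in D1) f (x, y).
Proof.
move=> mf f0.
have mfp : measurable_fun setT (f \_ (D1 `*` D2)).
  exact/(measurable_restrictT _ (measurableX mD1 mD2)).
rewrite integral_mkcond patch_integral_setX fubini_tonelli //; last first.
  by move=> z; apply: erestrict_ge0 => -[x y] []; exact: f0.
rewrite [RHS]integral_mkcond.
rewrite (patch_integral_setX _ _ _ (fun z => f (z.2, z.1))).
apply: eq_integral => y _; apply: eq_integral => x _.
by rewrite /patch !in_setX andbC.
Qed.

End Tonelli.

Lemma measurable_fun_inv d (T : measurableType d) (R : realType) (D : set T)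
    (f : T -> R) : (forall x, D x -> 0 <= f x) ->
  measurable_fun D f -> measurable_fun D (fun x => (f x)^-1).
Proof.
move=> f0 mf; apply: (eq_measurable_fun (fun x => f x `^ (-1))).
  by move=> x /set_mem Dx; rewrite powR_inv1 ?f0.
exact: measurableT_comp (measurable_powR _) mf.
Qed.

Lemma measurable_fun_sqrt d (T : measurableType d) (R : realType) (D : set T)
    (f : T -> R) :
  measurable_fun D f -> measurable_fun D (fun x => Num.sqrt (f x)).
Proof.
move=> mf; apply: (measurableT_comp _ mf).
exact: continuous_measurable_fun (@sqrt_continuous R).
Qed.

Section CauchySchwarz.
Context d (T : measurableType d) (R : realType).
Variables (mu : {measure set T -> \bar R}) (D : set T).
Hypothesis mD : measurable D.
Implicit Types f g k q u : T -> R.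

Lemma integral_sqr_ge0 f : (0 <= \int[mu]_(x in D) (f x ^+ 2)%:E)%E.
Proof. by apply: integral_ge0 => x _; rewrite lee_fin sqr_ge0. Qed.

Lemma integral_cauchy_schwarz f g :
  measurable_fun D f -> measurable_fun D g ->
  (\int[mu]_(x in D) `|f x * g x|%:E <=
   sqrte (\int[mu]_(x in D) (f x ^+ 2)%:E) *
   sqrte (\int[mu]_(x in D) (g x ^+ 2)%:E))%E.
Proof.
move=> mf mg.
have point0 : point = 0 :> R by [].
have Lnorm2E u : ('N[mu]_2%:E[EFin \o u \_ D] =
    sqrte (\int[mu]_(x in D) (u x ^+ 2)%:E))%E.
  rewrite unlock poweR12_sqrt; last first.
    by apply: integral_ge0 => *; exact: poweR_ge0.
  congr sqrte; rewrite [RHS]integral_mkcond; apply: eq_integral => x _.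
  rewrite /= powR_mulrn // real_normK ?num_real // /patch.
  by case: ifPn => // _; rewrite point0 expr0n.
have -> : (\int[mu]_(x in D) `|f x * g x|%:E =
    'N[mu]_1[EFin \o (f \_ D \* g \_ D)%R])%E.
  rewrite Lnorm1 integral_mkcond; apply: eq_integral => x _ /=.
  by rewrite /patch; case: ifPn => _ //=; rewrite point0 mulr0 normr0.
rewrite -!Lnorm2E; apply: hoelder => //; last by field.
- exact/(measurable_restrictT _ mD).
- exact/(measurable_restrictT _ mD).
Qed.

Lemma integral_cauchy_schwarz_weighted k q u :
  measurable_fun D k -> measurable_fun D q -> measurable_fun D u ->
  (forall x, D x -> 0 <= k x) -> (forall x, D x -> 0 < q x) ->
  ((\int[mu]_(x in D) (k x * `|u x|)%:E) ^+ 2 <=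
   \int[mu]_(x in D) (k x * q x)%:E *
   \int[mu]_(x in D) (k x * (u x ^+ 2 / q x))%:E)%E.
Proof.
move=> mk mq mfu k0 q0.
pose f x := Num.sqrt (k x * q x); pose g x := Num.sqrt (k x / q x) * u x.
have mf : measurable_fun D f by exact/measurable_fun_sqrt/measurable_funM.
have mg : measurable_fun D g.
  apply: measurable_funM => //; apply/measurable_fun_sqrt/measurable_funM => //.
  by apply: measurable_fun_inv => // x /q0/ltW.
have fgE x : D x -> k x * `|u x| = `|f x * g x|.
  move=> Dx; have [kx qx] := (k0 x Dx, q0 x Dx).
  rewrite /f /g mulrA -sqrtrM ?mulr_ge0 ?(ltW qx) // mulrACA divff ?gt_eqF //.
  by rewrite mulr1 -expr2 sqrtr_sqr normrM normr_id (ger0_norm kx).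
have f2E x : D x -> k x * q x = f x ^+ 2.
  by move=> Dx; rewrite sqr_sqrtr // mulr_ge0 ?k0 // ltW ?q0.
have g2E x : D x -> k x * (u x ^+ 2 / q x) = g x ^+ 2.
  move=> Dx; rewrite exprMn sqr_sqrtr ?divr_ge0 ?k0 // ?ltW ?q0 //.
  by rewrite [RHS]mulrAC mulrA.
under eq_integral => x /set_mem Dx do rewrite fgE //.
under [X in (X * _)%E]eq_integral => x /set_mem Dx do rewrite f2E //.
under [X in (_ * X)%E]eq_integral => x /set_mem Dx do rewrite g2E //.
rewrite -[leRHS]sqr_sqrte ?mule_ge0 ?integral_sqr_ge0 //.
rewrite lee_sqr ?sqrte_ge0 ?integral_ge0 //.
by rewrite sqrteM ?integral_sqr_ge0 // integral_cauchy_schwarz.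
Qed.

Definition square_integrable f : Prop :=
  measurable_fun D f /\ (\int[mu]_(x in D) (f x ^+ 2)%:E < +oo)%E.

Lemma square_integrable_sqrte f : square_integrable f ->
  sqrte (\int[mu]_(x in D) (f x ^+ 2)%:E) =
  (Num.sqrt (\int[mu]_(x in D) (f x ^+ 2)))%:E.
Proof.
move=> [_ f2]; rewrite -[in LHS](@fineK _ (\int[mu]_(x in D) _)%E) //.
by rewrite ge0_fin_numE // integral_sqr_ge0.
Qed.

Lemma square_integrableM f g : square_integrable f -> square_integrable g ->
  mu.-integrable D (EFin \o (fun x => f x * g x)).
Proof.
move=> f2 g2; have [[mf _] [mg _]] := (f2, g2).
apply/integrableP; split; first exact/measurable_EFinP/measurable_funM.
apply: le_lt_trans (integral_cauchy_schwarz mf mg) _.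
by rewrite !square_integrable_sqrte // -EFinM ltry.
Qed.

Lemma Rintegral_cauchy_schwarz f g :
  square_integrable f -> square_integrable g ->
  `|\int[mu]_(x in D) (f x * g x)| <=
  Num.sqrt (\int[mu]_(x in D) (f x ^+ 2)) *
  Num.sqrt (\int[mu]_(x in D) (g x ^+ 2)).
Proof.
move=> f2 g2; have fgi := square_integrableM f2 g2.
apply: le_trans (le_normr_Rintegral mD fgi) _.
rewrite -lee_fin EFinM -!square_integrable_sqrte // fineK.
  exact: integral_cauchy_schwarz f2.1 g2.1.
exact: integrable_fin_num (integrable_norm fgi).
Qed.

End CauchySchwarz.

Section MeasurableRectangles.
Context (d1 d2 d3 : measure_display).
Context (T1 : measurableType d1) (T2 : measurableType d2).
Context (T3 : measurableType d3) (D1 : set T1) (D2 : set T2).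
Hypotheses (mD1 : measurable D1) (mD2 : measurable D2).

Lemma measurable_pair1_setX (f : T1 * T2 -> T3) x : D1 x ->
  measurable_fun (D1 `*` D2) f -> measurable_fun D2 (fun y => f (x, y)).
Proof.
move=> D1x mf; apply: measurable_comp mf _; first exact: measurableX.
  by move=> _ [y D2y <-].
exact: measurable_funTS (pair1_measurable x).
Qed.

Lemma measurable_pair2_setX (f : T1 * T2 -> T3) y : D2 y ->
  measurable_fun (D1 `*` D2) f -> measurable_fun D1 (fun x => f (x, y)).
Proof.
move=> D2y mf; apply: measurable_comp mf _; first exact: measurableX.
  by move=> _ [x D1x <-].
exact: measurable_funTS (pair2_measurable y).
Qed.

Lemma measurable_fst_setX (f : T1 -> T3) :
  measurable_fun D1 f -> measurable_fun (D1 `*` D2) (f \o fst).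
Proof.
move=> mf; apply: measurable_comp mf (measurable_funTS measurable_fst) => //.
by move=> _ [[x y] [D1x _] <-].
Qed.

Lemma measurable_snd_setX (f : T2 -> T3) :
  measurable_fun D2 f -> measurable_fun (D1 `*` D2) (f \o snd).
Proof.
move=> mf; apply: measurable_comp mf (measurable_funTS measurable_snd) => //.
by move=> _ [[x y] [_ D2y] <-].
Qed.

End MeasurableRectangles.

Lemma measurable_kernel_integral d1 d2 (T1 : measurableType d1)
    (T2 : measurableType d2) (R : realType)
    (mu : {sigma_finite_measure set T2 -> \bar R}) (D1 : set T1) (D2 : set T2)
    (k : T1 * T2 -> R) (u : T2 -> R) :
  measurable D1 -> measurable D2 ->
  measurable_fun (D1 `*` D2) k -> measurable_fun D2 u ->
  measurable_fun D1 (fun x => \int[mu]_(y in D2) (k (x, y) * u y)%:E)%E.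
Proof.
move=> mD1 mD2 mk mfu.
apply: (measurable_integral_setX mD1 mD2 mu (f := fun z => (k z * u z.2)%:E)).
apply/measurable_EFinP; apply: measurable_funM mk _.
exact: (measurable_snd_setX mD2 mfu).
Qed.

Section SchurTest.
Context d1 d2 (T1 : measurableType d1) (T2 : measurableType d2) (R : realType).
Variable mu1 : {sigma_finite_measure set T1 -> \bar R}.
Variable mu2 : {sigma_finite_measure set T2 -> \bar R}.
Variables (D1 : set T1) (D2 : set T2) (k : T1 * T2 -> R).
Variables (p : T1 -> R) (q : T2 -> R) (A B : R).
Hypotheses (mD1 : measurable D1) (mD2 : measurable D2).
Hypothesis mk : measurable_fun (D1 `*` D2) k.
Hypothesis k_ge0 : forall x y, D1 x -> D2 y -> 0 <= k (x, y).
Hypotheses (mp : measurable_fun D1 p) (mq : measurable_fun D2 q).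
Hypothesis p_ge0 : forall x, D1 x -> 0 <= p x.
Hypothesis q_gt0 : forall y, D2 y -> 0 < q y.
Hypotheses (A_ge0 : 0 <= A) (B_ge0 : 0 <= B).
Hypothesis row_bound : forall x, D1 x ->
  (\int[mu2]_(y in D2) (k (x, y) * q y)%:E <= (A * p x)%:E)%E.
Hypothesis col_bound : forall y, D2 y ->
  (\int[mu1]_(x in D1) (k (x, y) * p x)%:E <= (B * q y)%:E)%E.
Variable u : T2 -> R.
Hypothesis measurable_u : measurable_fun D2 u.

Definition schur_integrand z : R := p z.1 * (k z * (u z.2 ^+ 2 / q z.2)).

Let measurable_sqr_div : measurable_fun D2 (fun y => u y ^+ 2 / q y).
Proof.
apply: measurable_funM; first exact: measurable_funX.
by apply: measurable_fun_inv => // y /q_gt0/ltW.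
Qed.

Lemma measurable_schur_integrand :
  measurable_fun (D1 `*` D2) (EFin \o schur_integrand).
Proof.
apply/measurable_EFinP/measurable_funM.
  exact: (measurable_fst_setX mD1 mp).
exact: (measurable_funM mk (measurable_snd_setX mD2 measurable_sqr_div)).
Qed.

Let sqr_div_ge0 y : D2 y -> 0 <= u y ^+ 2 / q y.
Proof. by move=> D2y; rewrite divr_ge0 ?sqr_ge0 // ltW ?q_gt0. Qed.

Lemma schur_integrand_ge0 x y : D1 x -> D2 y ->
  (0 <= (schur_integrand (x, y))%:E)%E.
Proof.
move=> D1x D2y; rewrite lee_fin mulr_ge0 ?p_ge0 //.
by rewrite mulr_ge0 ?k_ge0 ?sqr_div_ge0.
Qed.

Lemma schur_test_row x : D1 x ->
  ((\int[mu2]_(y in D2) (k (x, y) * `|u y|)%:E) ^+ 2 <=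
   A%:E * \int[mu2]_(y in D2) (schur_integrand (x, y))%:E)%E.
Proof.
move=> D1x; have mkx := measurable_pair1_setX mD1 mD2 D1x mk.
apply: le_trans (integral_cauchy_schwarz_weighted mu2 mD2 mkx mq measurable_u
  (fun y => k_ge0 D1x) q_gt0) _.
have integrand_ge0 y : D2 y -> 0 <= k (x, y) * (u y ^+ 2 / q y).
  by move=> D2y; rewrite mulr_ge0 ?k_ge0 ?sqr_div_ge0.
have -> : (\int[mu2]_(y in D2) (schur_integrand (x, y))%:E =
    (p x)%:E * \int[mu2]_(y in D2) (k (x, y) * (u y ^+ 2 / q y))%:E)%E.
  rewrite -ge0_integralZl_EFin ?p_ge0 //.
  exact/measurable_EFinP/measurable_funM.
by rewrite muleA -EFinM lee_wpmul2r ?row_bound // integral_ge0.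
Qed.

Lemma schur_test_col y : D2 y ->
  (\int[mu1]_(x in D1) (schur_integrand (x, y))%:E <= B%:E * (u y ^+ 2)%:E)%E.
Proof.
move=> D2y.
have integrandE x : schur_integrand (x, y) = u y ^+ 2 / q y * (k (x, y) * p x).
  by rewrite /schur_integrand /=; ring.
under eq_integral do rewrite integrandE EFinM.
rewrite ge0_integralZl_EFin ?sqr_div_ge0 //; first last.
- apply/measurable_EFinP/measurable_funM => //.
  exact: measurable_pair2_setX D2y mk.
- by move=> x D1x; rewrite lee_fin mulr_ge0 ?k_ge0 ?p_ge0.
apply: (@le_trans _ _ ((u y ^+ 2 / q y)%:E * (B * q y)%:E)%E).
  by rewrite lee_wpmul2l ?col_bound // lee_fin sqr_div_ge0.
by rewrite -!EFinM lee_fin mulrCA divfK // gt_eqF ?q_gt0.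
Qed.

Lemma schur_test :
  (\int[mu1]_(x in D1) (\int[mu2]_(y in D2) (k (x, y) * `|u y|)%:E) ^+ 2 <=
   (A * B)%:E * \int[mu2]_(y in D2) (u y ^+ 2)%:E)%E.
Proof.
apply: (@le_trans _ _ (\int[mu1]_(x in D1)
    (A%:E * \int[mu2]_(y in D2) (schur_integrand (x, y))%:E))%E).
  apply: ge0_le_integral => //.
  - by move=> x _; exact: sqre_ge0.
  - under eq_fun do rewrite expe2.
    by apply: emeasurable_funM; apply: measurable_kernel_integral => //;
      exact: measurableT_comp.
  - apply: emeasurable_funM => //.
    exact: measurable_integral_setX measurable_schur_integrand.
  - exact: schur_test_row.
rewrite ge0_integralZl_EFin //; first last.
- exact: measurable_integral_setX measurable_schur_integrand.
- by move=> x D1x; apply: integral_ge0 => y; exact: schur_integrand_ge0.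
rewrite (fubini_tonelli_setX mD1 mD2 mu1 mu2 measurable_schur_integrand);
  last exact: schur_integrand_ge0.
rewrite EFinM -muleA lee_wpmul2l // -ge0_integralZl_EFin //; first last.
- exact/measurable_EFinP/measurable_funX.
- by move=> y _; rewrite lee_fin sqr_ge0.
apply: ge0_le_integral => //.
- by move=> y D2y; apply: integral_ge0 => x D1x; exact: schur_integrand_ge0.
- exact: (measurable_integral_setX_swap mu1 mD1 mD2 measurable_schur_integrand).
- by apply/measurable_EFinP/measurable_funM => //; exact: measurable_funX.
- exact: schur_test_col.
Qed.

End SchurTest.

Section LayeredIntegral.
Context d (T : measurableType d) (R : realType).
Variable mu : {measure set T -> \bar R}.
Local Open Scope ereal_scope.

Lemma ge0_le_integralZl (D : set T) (f g : T -> R) (a : R) :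
  measurable D -> measurable_fun D f -> measurable_fun D g -> (0 <= a)%R ->
  (forall x, D x -> (0 <= f x)%R) -> (forall x, D x -> (0 <= g x)%R) ->
  (forall x, D x -> (f x <= a * g x)%R) ->
  \int[mu]_(x in D) (f x)%:E <= a%:E * \int[mu]_(x in D) (g x)%:E.
Proof.
move=> mD mf mg a0 f0 g0 fg.
rewrite -ge0_integralZl_EFin //; last exact/measurable_EFinP.
apply: ge0_le_integral => //.
- exact/measurable_EFinP.
- exact/measurable_EFinP/measurable_funM.
Qed.

Lemma ge0_integral_le_layers (D : set T) (F : nat -> set T) (c : nat -> R)
    (g : T -> \bar R) :
  measurable D -> (forall k, measurable (F k)) -> measurable_fun D g ->
  (forall x, D x -> 0 <= g x) -> (forall k, (0 <= c k)%R) ->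
  (forall x, D x -> exists2 k, F k x & g x <= (c k)%:E) ->
  \int[mu]_(x in D) g x <= \sum_(k <oo) (c k)%:E * mu (D `&` F k).
Proof.
move=> mD mF mg g0 c0 layer.
pose G k x := (c k * \1_(F k) x)%:E.
have G0 k x : 0 <= G k x by rewrite lee_fin mulr_ge0.
have mG k : measurable_fun D (G k).
  by apply/measurable_EFinP; apply: measurable_funM.
have -> : \sum_(k <oo) (c k)%:E * mu (D `&` F k) =
    \int[mu]_(x in D) \sum_(k <oo) G k x.
  rewrite integral_nneseries //; apply: eq_eseriesr => k _.
  under [RHS]eq_integral do rewrite /G EFinM.
  rewrite ge0_integralZl_EFin //; last exact/measurable_EFinP/measurable_indic.
  by rewrite integral_indic // setIC.
apply: ge0_le_integral => //.
  by apply: ge0_emeasurable_sum => // k x _ _; exact: G0.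
move=> x Dx; have [k Fkx gc] := layer x Dx; apply: (le_trans gc).
apply: le_trans (nneseries_lim_ge k.+1 _) => //=.
rewrite big_nat_recr //= -[leLHS]add0e; apply: leeD; first exact: sume_ge0.
by rewrite lee_fin indicE mem_set ?mulr1.
Qed.

Lemma nneseries_geometric (a q : R) : (0 <= q < 1)%R ->
  \sum_(k <oo) (a * q ^+ k)%:E = (a / (1 - q))%:E.
Proof.
move=> /andP[q0 q1]; apply: cvg_lim => //.
have q_lt1 : (`|q| < 1)%R by rewrite ger0_norm.
under eq_fun do rewrite sumEFin.
by apply: cvg_EFin; [exact: nearW|exact: cvg_geometric_series].
Qed.

End LayeredIntegral.

Section RintegralLinearity.
Context d (T : measurableType d) (R : realType).
Variables (mu : {measure set T -> \bar R}) (D : set T).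
Hypothesis mD : measurable D.
Implicit Types f : T -> R.

Lemma integrable_EFinZl (c : R) f : mu.-integrable D (EFin \o f) ->
  mu.-integrable D (EFin \o (fun x => c * f x)).
Proof. by move=> fi; apply: eq_integrable (integrableZl mD c fi). Qed.

Lemma integrable_EFin_sum (f : nat -> T -> R) N :
  (forall n, mu.-integrable D (EFin \o f n)) ->
  mu.-integrable D (EFin \o (fun x => \sum_(0 <= n < N) f n x)).
Proof.
move=> fi.
apply: (@eq_integrable _ _ _ mu D mD (fun x => \sum_(0 <= n < N) (f n x)%:E)%E).
  by move=> x _ /=; rewrite sumEFin.
by apply: integrable_sum => // n _; exact: fi.
Qed.

Lemma Rintegral_sum (f : nat -> T -> R) N :
  (forall n, mu.-integrable D (EFin \o f n)) ->
  \int[mu]_(x in D) (\sum_(0 <= n < N) f n x) =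
  \sum_(0 <= n < N) \int[mu]_(x in D) f n x.
Proof.
move=> fi; elim: N => [|N IH].
  under eq_Rintegral do rewrite big_geq //.
  by rewrite Rintegral_cst // mul0r big_geq.
under eq_Rintegral do rewrite big_nat_recr //=.
by rewrite RintegralD // ?IH ?big_nat_recr //; exact: integrable_EFin_sum.
Qed.

Lemma measure_mul_le_Rintegral (A : set T) f (c : R) :
  measurable A -> A `<=` D -> (mu A < +oo)%E ->
  mu.-integrable D (EFin \o f) ->
  (forall x, D x -> 0 <= f x) -> (forall x, A x -> c <= f x) ->
  fine (mu A) * c <= \int[mu]_(x in D) f x.
Proof.
move=> mA AD muA fi f0 cf; have AIDE : A `&` D = A by exact/setIidPl.
have indicA : mu.-integrable D (EFin \o \1_A).
  apply/integrableP; split; first exact/measurable_EFinP/measurable_indic.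
  under eq_integral do rewrite /= ger0_norm //.
  by rewrite integral_indic // AIDE.
have -> : fine (mu A) * c = \int[mu]_(x in D) (c * \1_A x).
  by rewrite RintegralZl // mulrC /Rintegral integral_indic // AIDE.
apply: le_Rintegral => //; first exact: integrable_EFinZl.
move=> x Dx; rewrite indicE; have [/set_mem Ax|_] := boolP (x \in A).
  by rewrite mulr1 cf.
by rewrite mulr0 f0.
Qed.

End RintegralLinearity.

Definition power_growth d (T : measurableType d) (R : realType)
    (mu : set T -> \bar R) (D : set T) (tau : T -> R) (alpha C : R) : Prop :=
  forall r : R, 0 < r ->
    (mu (D `&` [set x | tau x <= r])%R <= (C * r `^ alpha)%:E)%E.

(* The sum over [k : nat] of [2 `^ (e - a * k)], for [a > 0]. *)
Definition dyadic_sum (R : realType) (e a : R) : R :=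
  2 `^ e / (1 - 2 `^ (- a)).

Lemma dyadic_sum_ge0 (R : realType) (e a : R) : 0 <= a -> 0 <= dyadic_sum e a.
Proof.
move=> a0; rewrite divr_ge0 ?powR_ge0 // subr_ge0 -[leRHS](@powRr0 R 2).
by rewrite ler_powR ?ler1n // oppr_le0.
Qed.

Section PowerGrowth.
Context d (T : measurableType d) (R : realType).
Variables (mu : {measure set T -> \bar R}) (D : set T) (tau : T -> R).
Variables (alpha C : R).
Hypotheses (mD : measurable D) (mtau : measurable_fun D tau).
Hypothesis tau_gt0 : forall x, D x -> 0 < tau x.
Hypothesis growth : power_growth mu D tau alpha C.

Local Notation sublevel r := (D `&` [set x | tau x <= r]).
Local Notation superlevel r := (D `&` [set x | r < tau x]).

Lemma power_growth_cst_ge0 : 0 <= C.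
Proof.
by have := growth ltr01; rewrite powR1 mulr1 -lee_fin; exact: le_trans.
Qed.
Let C_ge0 := power_growth_cst_ge0.

Lemma measurable_sublevel r : measurable (sublevel r).
Proof. by have := mtau mD (measurable_itv `]-oo, r]); rewrite set_itvE. Qed.

Lemma measurable_superlevel r : measurable (superlevel r).
Proof. by have := mtau mD (measurable_itv `]r, +oo[); rewrite set_itvE. Qed.

Lemma measurable_powR_tau (E : set T) b : E `<=` D ->
  measurable_fun E (fun x => tau x `^ b).
Proof.
move=> ED; apply: measurableT_comp (measurable_powR _) _.
exact: measurable_funS mD ED mtau.
Qed.

Lemma integral_le_geometric_layers (E : set T) (g : T -> R) (c r : nat -> R)
    (A q : R) :
  measurable E -> E `<=` D -> measurable_fun E g ->
  (forall x, E x -> 0 <= g x) -> (forall k, 0 <= c k) -> (forall k, 0 < r k) ->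
  0 <= q < 1 -> (forall k, c k * r k `^ alpha = A * q ^+ k) ->
  (forall x, E x -> exists2 k, tau x <= r k & g x <= c k) ->
  (\int[mu]_(x in E) (g x)%:E <= (C * (A / (1 - q)))%:E)%E.
Proof.
move=> mE ED mg g0 c0 r0 q01 crE layer.
apply: (@le_trans _ _ (\sum_(k <oo) (c k)%:E * mu (sublevel (r k)))%E).
  apply: le_trans (lee_nneseries _ _).
  apply: (@ge0_integral_le_layers _ _ _ _ _ (fun k => sublevel (r k)) c) => //.
  - by move=> k; exact: measurable_sublevel.
  - exact/measurable_EFinP.
  - move=> x Ex; have [k tauk gk] := layer x Ex.
    by exists k => //; split=> //; exact: ED.
  - by move=> k _ _; rewrite mule_ge0 ?lee_fin.
  - move=> k _; rewrite lee_wpmul2l ?lee_fin // le_measure ?inE //.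
      by apply: measurableI => //; exact: measurable_sublevel.
    exact: measurable_sublevel.
rewrite mulrA -nneseries_geometric //.
apply: lee_nneseries => [k _ _|k _]; first by rewrite mule_ge0 ?lee_fin.
apply: le_trans (lee_wpmul2l _ (growth (r0 k))) _; first by rewrite lee_fin.
by rewrite -EFinM lee_fin mulrCA crE mulrA.
Qed.

Lemma integral_powR_sublevel b r : 0 <= b -> b < alpha -> 0 < r ->
  (\int[mu]_(x in sublevel r) (tau x `^ (- b))%:E <=
   (C * (dyadic_sum b (alpha - b) * r `^ (alpha - b)))%:E)%E.
Proof.
move=> b0 b_lt r0; have pow2 n : 0 < 2 ^+ n :> R by exact: exprn_gt0.
rewrite /dyadic_sum mulrAC.
apply: (@integral_le_geometric_layers _ _ (fun k => (r / 2 ^+ k.+1) `^ (- b))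
  (fun k => r / 2 ^+ k)) => //.
- exact: measurable_sublevel.
- exact: measurable_powR_tau.
- by move=> x _; exact: powR_ge0.
- by move=> k; exact: powR_ge0.
- by move=> k; rewrite divr_gt0.
- by rewrite powR_ge0 powR_lt1 ?ltr1n // oppr_lt0 subr_gt0.
- move=> k; have coeffE : (2 ^+ k.+1 : R)^-1 `^ (- b) = (2 `^ b) ^+ k.+1.
    by rewrite powRN_inv ?invr_ge0 ?ltW // invrK exprn_powR.
  have radiusE : (2 ^+ k : R)^-1 `^ alpha = (2 `^ (- alpha)) ^+ k.
    by rewrite -powRN_inv ?ltW // exprn_powR.
  rewrite !powRM ?invr_ge0 ?(ltW r0) ?(ltW (pow2 _)) // coeffE radiusE.
  by rewrite opprB !gt0_powRD // exprMn exprS; ring.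
- move=> x [Dx xr]; have [k /andP[lek ltk]] := dyadic_bracket (tau_gt0 Dx) xr.
  exists k; first by rewrite ler_pdivlMr.
  by rewrite ge0_ger_powRN ?divr_gt0 // ler_pdivrMr // ltW.
Qed.

Lemma integral_powR_superlevel c r : 0 <= alpha -> alpha < c -> 0 < r ->
  (\int[mu]_(x in superlevel r) (tau x `^ (- c))%:E <=
   (C * (dyadic_sum alpha (c - alpha) * r `^ (alpha - c)))%:E)%E.
Proof.
move=> alpha0 c_gt r0; have pow2 n : 0 < 2 ^+ n :> R by exact: exprn_gt0.
rewrite /dyadic_sum mulrAC.
apply: (@integral_le_geometric_layers _ _ (fun k => (r * 2 ^+ k) `^ (- c))
  (fun k => r * 2 ^+ k.+1)) => //.
- exact: measurable_superlevel.
- exact: measurable_powR_tau.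
- by move=> x _; exact: powR_ge0.
- by move=> k; exact: powR_ge0.
- by move=> k; rewrite mulr_gt0.
- by rewrite powR_ge0 powR_lt1 ?ltr1n // oppr_lt0 subr_gt0.
- move=> k; rewrite !powRM ?(ltW r0) ?(ltW (pow2 _)) //.
  by rewrite !exprn_powR // opprB !gt0_powRD // exprMn exprS; ring.
- move=> x [Dx /ltW rx]; have [k /andP[lek ltk]] := dyadic_bracket r0 rx.
  exists k; first exact: ltW.
  by apply: ge0_ger_powRN; rewrite ?mulr_gt0 // (le_trans alpha0) // ltW.
Qed.

Lemma integral_le_level_split (g : T -> R) (a1 a2 b c r : R) :
  0 <= alpha -> 0 <= b -> b < alpha -> alpha < c -> 0 < r ->
  0 <= a1 -> 0 <= a2 ->
  measurable_fun D g -> (forall x, D x -> 0 <= g x) ->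
  (forall x, D x -> tau x <= r -> g x <= a1 * tau x `^ (- b)) ->
  (forall x, D x -> r < tau x -> g x <= a2 * tau x `^ (- c)) ->
  (\int[mu]_(x in D) (g x)%:E <=
   (C * (dyadic_sum b (alpha - b) * (a1 * r `^ (alpha - b)) +
         dyadic_sum alpha (c - alpha) * (a2 * r `^ (alpha - c))))%:E)%E.
Proof.
move=> alpha0 b0 b_lt c_gt r0 a10 a20 mg g0 g_sub g_super.
have DE : D = sublevel r `|` superlevel r.
  rewrite -setIUr; apply/esym/setIidPl => x _ /=.
  by have [|] := leP (tau x) r; [left|right].
have disj : [disjoint sublevel r & superlevel r].
  by apply/disj_setPS => x [[_ /= xr] [_ /=]]; rewrite ltNge xr.
have bound_on (E : set T) a e : measurable E -> E `<=` D -> 0 <= a ->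
    (forall x, E x -> g x <= a * tau x `^ (- e)) ->
    (\int[mu]_(x in E) (g x)%:E <=
     a%:E * \int[mu]_(x in E) (tau x `^ (- e))%:E)%E.
  move=> mE ED a0 g_le; apply: ge0_le_integralZl => //.
  - exact: measurable_funS mD ED mg.
  - exact: measurable_powR_tau.
  - by move=> x /ED/g0.
  - by move=> x _; exact: powR_ge0.
have [msub msuper] := (measurable_sublevel r, measurable_superlevel r).
have {1}-> : D = sublevel r `|` superlevel r by [].
rewrite ge0_integral_setU -?DE //; last exact/measurable_EFinP.
rewrite mulrDr EFinD; apply: leeD.
- apply: le_trans (bound_on _ a1 b msub _ a10 _) _ => //.
    by move=> x [Dx xr]; exact: g_sub.
  rewrite (mulrCA _ a1) (mulrCA C a1) EFinM lee_wpmul2l //.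
  exact: integral_powR_sublevel.
- apply: le_trans (bound_on _ a2 c msuper _ a20 _) _ => //.
    by move=> x [Dx xr]; exact: g_super.
  rewrite (mulrCA _ a2) (mulrCA C a2) EFinM lee_wpmul2l //.
  exact: integral_powR_superlevel.
Qed.

Lemma integral_homogeneous_kernel b : 0 < b -> b < alpha ->
  exists2 K : R, 0 <= K & forall y : R, 0 < y ->
  (\int[mu]_(x in D) ((tau x + y) `^ (- alpha) * tau x `^ (- b))%:E <=
   (K * y `^ (- b))%:E)%E.
Proof.
move=> b0 b_lt; have alpha0 := lt_trans b0 b_lt.
exists (C * (dyadic_sum b (alpha - b) + dyadic_sum alpha b)).
  by rewrite mulr_ge0 ?addr_ge0 ?dyadic_sum_ge0 // ?subr_ge0 ltW.
move=> y y0; apply: le_trans (@integral_le_level_split _ (y `^ (- alpha)) 1 b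
  (alpha + b) y _ _ _ _ _ _ _ _ _ _ _) _ => //.
- exact: ltW.
- exact: ltW.
- by rewrite ltrDl.
- exact: powR_ge0.
- apply: measurable_funM; last exact: measurable_powR_tau.
  apply: measurableT_comp (measurable_powR _) _.
  exact: measurable_funD.
- by move=> x _; rewrite mulr_ge0 ?powR_ge0.
- move=> x Dx _; rewrite ler_wpM2r ?powR_ge0 // ge0_ger_powRN ?(ltW alpha0) //.
  by rewrite lerDr ltW ?tau_gt0.
- move=> x Dx _; rewrite mul1r opprD gt0_powRD ?tau_gt0 //.
  rewrite ler_wpM2r ?powR_ge0 // ge0_ger_powRN ?(ltW alpha0) ?tau_gt0 //.
  by rewrite lerDl ltW.
- rewrite mul1r -gt0_powRD // addrA addNr add0r opprD addrA subrr add0r.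
  by rewrite [alpha + b]addrC addrK -mulrDl mulrA.
Qed.

Lemma integral_expRN : 0 < alpha ->
  exists2 K : R, 0 <= K & forall L : R, 0 < L ->
  (\int[mu]_(x in D) (expR (- (L * tau x)))%:E <= (K * L `^ (- alpha))%:E)%E.
Proof.
move=> alpha0; pose c := alpha + 1.
have c0 : 0 < c by rewrite addr_gt0.
exists (C * (dyadic_sum 0 alpha + dyadic_sum alpha 1 * c `^ c)).
  apply: mulr_ge0 => //; apply: addr_ge0; first exact/dyadic_sum_ge0/ltW.
  by apply: mulr_ge0; rewrite ?dyadic_sum_ge0 ?powR_ge0.
move=> L L0; apply: le_trans (@integral_le_level_split _ 1
  (c `^ c * L `^ (- c)) 0 c L^-1 _ _ _ _ _ _ _ _ _ _ _) _ => //.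
- exact: ltW.
- by rewrite ltrDl.
- by rewrite invr_gt0.
- by rewrite mulr_ge0 ?powR_ge0.
- apply: measurableT_comp; first exact: measurable_expR.
  by apply: measurableT_comp => //; exact: measurable_funM.
- move=> x Dx _; rewrite oppr0 powRr0 mulr1 -expR0 ler_expR oppr_le0.
  by rewrite mulr_ge0 // ltW ?tau_gt0.
- move=> x Dx _; have tau0 := tau_gt0 Dx.
  have Ltau0 : 0 < L * tau x by exact: mulr_gt0.
  rewrite -mulrA -powRM ?(ltW L0) ?(ltW tau0) // expRN powRN.
  rewrite ler_pdivlMr ?powR_gt0 // mulrC ler_pdivrMr ?expR_gt0 //.
  by rewrite powR_le_expR ?(ltW Ltau0).
- rewrite subr0 mul1r -!powRN_inv ?(ltW L0) // -mulrA -gt0_powRD //.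
  rewrite opprB addrA addNr add0r.
  by rewrite [c - alpha]addrAC subrr add0r -mulrA mulrDl mulrA.
Qed.

End PowerGrowth.

Lemma power_growth_of_small_radii d (T : measurableType d) (R : realType)
    (mu : {finite_measure set T -> \bar R}) (D : set T) (tau : T -> R)
    (alpha C r0 : R) :
  measurable D -> measurable_fun D tau -> 0 <= alpha -> 0 < r0 -> 0 <= C ->
  (forall r, 0 < r -> r < r0 ->
    (mu (D `&` [set x | tau x <= r])%R <= (C * r `^ alpha)%:E)%E) ->
  power_growth mu D tau alpha (C + fine (mu D) / r0 `^ alpha).
Proof.
move=> mD mtau alpha0 r00 C0 small r rpos.
have muD_ge0 : 0 <= fine (mu D) by exact: fine_ge0.
have [rr0|r0r] := ltP r r0.
  apply: le_trans (small _ rpos rr0) _.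
  by rewrite lee_fin ler_wpM2r ?powR_ge0 // lerDl divr_ge0 ?powR_ge0.
apply: (@le_trans _ _ (fine (mu D))%:E).
  rewrite fineK ?fin_num_measure // le_measure ?inE //.
  exact: measurable_sublevel.
rewrite lee_fin mulrDl ler_wpDl ?mulr_ge0 ?powR_ge0 //.
rewrite mulrAC -mulrA ler_peMr // ler_pdivlMr ?powR_gt0 // mul1r.
by apply: ge0_ler_powR => //; rewrite nnegrE ltW.
Qed.

Section HalfLine.
Context {R : realType}.
Implicit Types (s t : R) (m n : nat).

Lemma measurable_half_line : measurable (@half_line R).
Proof. exact: measurable_itv. Qed.

Lemma half_lineE s : half_line s = (2^-1 < s) :> Prop.
Proof. by rewrite /half_line /= in_itv /= andbT. Qed.

Lemma half_lineD_gt1 s t : half_line s -> half_line t -> 1 < s + t.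
Proof. by rewrite !half_lineE; lra. Qed.

Lemma natpowNM m n s :
  (m.+1 * n.+1)%:R `^ (- s) = m.+1%:R `^ (- s) * n.+1%:R `^ (- s) :> R.
Proof. by rewrite natrM powRM. Qed.

Lemma measurable_natpowN n (E : set R) :
  measurable_fun E (fun s : R => n.+1%:R `^ (- s)).
Proof. exact: measurableT_comp (measurable_powRr _) _. Qed.

Lemma natpowN_le1 n s : half_line s -> n.+1%:R `^ (- s) <= 1 :> R.
Proof.
rewrite half_lineE => hs; rewrite -[leRHS](@powRr0 _ n.+1%:R).
by apply: ler_powR; rewrite ?ler1n //; lra.
Qed.

End HalfLine.

Local Notation D := half_line.
#[local] Hint Extern 0 (measurable half_line) =>
  exact: measurable_half_line : core.

Section DirichletPolynomialIntegrals.
Context {R : realType} (nu : {finite_measure set R -> \bar R}).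
Implicit Types (a b : nat -> R) (u : R -> R) (n N : nat).

Definition moment n : R := \int[nu]_(s in D) (n%:R `^ (- s)).

Lemma moment_ge0 n : 0 <= moment n.
Proof. by apply: Rintegral_ge0 => s _; exact: powR_ge0. Qed.

Lemma integrable_natpowN_mul n u : nu.-integrable D (EFin \o u) ->
  nu.-integrable D (EFin \o (fun s => n.+1%:R `^ (- s) * u s)).
Proof.
move=> ui; apply: le_integrable (ui) => //.
  apply/measurable_EFinP/measurable_funM; first exact: measurable_natpowN.
  exact/measurable_EFinP/measurable_int/ui.
move=> s Ds; rewrite /= lee_fin normrM ger0_norm ?powR_ge0 //.
by rewrite ler_piMl // natpowN_le1.
Qed.

Lemma integrable_natpowN n :
  nu.-integrable D (EFin \o (fun s => n.+1%:R `^ (- s))).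
Proof.
apply: eq_integrable (integrable_natpowN_mul n (u := fun=> 1) _) => //.
  by move=> s _ /=; rewrite mulr1.
exact: finite_measure_integrable_cst.
Qed.

Lemma integrable_dirichlet_poly_mul a N u : nu.-integrable D (EFin \o u) ->
  nu.-integrable D (EFin \o (fun s => dirichlet_poly a N s * u s)).
Proof.
move=> ui.
under [X in _ \o X]eq_fun do rewrite mulr_suml.
apply: integrable_EFin_sum => // n.
under [X in _ \o X]eq_fun do rewrite -mulrA.
exact/integrable_EFinZl/integrable_natpowN_mul.
Qed.

Lemma Rintegral_dirichlet_poly_mul a N u : nu.-integrable D (EFin \o u) ->
  \int[nu]_(s in D) (dirichlet_poly a N s * u s) =
  \sum_(0 <= n < N) a n.+1 * \int[nu]_(s in D) (n.+1%:R `^ (- s) * u s).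
Proof.
move=> ui.
under eq_Rintegral do rewrite mulr_suml.
under eq_Rintegral do under eq_bigr do rewrite -mulrA.
rewrite Rintegral_sum // => [|n]; last first.
  exact/integrable_EFinZl/integrable_natpowN_mul.
by apply: eq_bigr => n _; rewrite RintegralZl //; exact: integrable_natpowN_mul.
Qed.

Lemma integrable_dirichlet_poly a N :
  nu.-integrable D (EFin \o dirichlet_poly a N).
Proof.
apply: eq_integrable (integrable_dirichlet_poly_mul a N (u := fun=> 1) _) => //.
  by move=> s _ /=; rewrite mulr1.
exact: finite_measure_integrable_cst.
Qed.

Lemma integrable_dirichlet_poly_sqr a N :
  nu.-integrable D (EFin \o (fun s => dirichlet_poly a N s ^+ 2)).
Proof. exact/integrable_dirichlet_poly_mul/integrable_dirichlet_poly. Qed.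

Lemma square_integrable_dirichlet_poly a N :
  square_integrable nu D (dirichlet_poly a N).
Proof.
split; first exact: measurable_funTS (measurable_dirichlet_poly _ _).
exact: integrable_lty (integrable_dirichlet_poly_sqr a N).
Qed.

Lemma Rintegral_dirichlet_polyM a b N :
  \int[nu]_(s in D) (dirichlet_poly a N s * dirichlet_poly b N s) =
  \sum_(0 <= m < N) \sum_(0 <= n < N) a m.+1 * b n.+1 * moment (m.+1 * n.+1).
Proof.
rewrite Rintegral_dirichlet_poly_mul; last exact: integrable_dirichlet_poly.
apply: eq_bigr => m _; under eq_Rintegral do rewrite mulrC.
rewrite Rintegral_dirichlet_poly_mul ?mulr_sumr; last exact: integrable_natpowN.
apply: eq_bigr => n _; rewrite mulrA; congr (_ * _).
by apply: eq_Rintegral => s _; rewrite mulnC natpowNM.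
Qed.

End DirichletPolynomialIntegrals.

Section FiniteComplexSums.
Context {R : realType}.
Implicit Types (F a : nat -> R[i]) (x : nat -> R) (n N : nat).

Lemma cabs_real (r : R) : cabs r%:C = `|r|.
Proof. by rewrite /= expr0n addr0 sqrtr_sqr. Qed.

Lemma cabs_ge0 (z : R[i]) : 0 <= cabs z.
Proof. by case: z => x y; exact: sqrtr_ge0. Qed.

Lemma ler_cabs_sum F N :
  cabs (\sum_(0 <= n < N) F n) <= \sum_(0 <= n < N) cabs (F n).
Proof.
apply: (big_ind2 (fun (z : R[i]) (r : R) => cabs z <= r)) => //.
  by rewrite ComplexField.Normc.normc0.
by move=> z1 z2 r1 r2 le1 le2; apply: le_trans (lerD le1 le2); exact: le_normcD.
Qed.

Lemma fsbig_positive_nat F N : (forall n, (N < n)%N -> F n = 0) ->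
  \sum_(n \in [set n | (1 <= n)%N]) F n = \sum_(0 <= n < N) F n.+1.
Proof.
move=> F0; have -> : \sum_(0 <= n < N) F n.+1 = \sum_(1 <= n < N.+1) F n.
  by rewrite big_add1.
rewrite /index_iota subn1 /= (fsbigE (iota 1 N)) ?iota_uniq //.
- rewrite big_mkcond [RHS]big_seq_cond [LHS]big_seq_cond; apply: eq_bigr => n.
  by rewrite mem_iota andbT => /andP[n1 _]; rewrite mem_set.
- by move=> n /=; rewrite mem_iota => /andP[].
- by move=> n /= n1; rewrite mem_iota n1 /= add1n ltnS -ltnNge; exact: F0.
Qed.

Lemma finitely_supported_bound a : finitely_supported a ->
  exists N, forall n, (N < n)%N -> a n = 0.
Proof.
move=> /finite_seqP[s sE]; exists (\max_(i <- s) i) => n sn.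
apply/eqP; apply: contraTT sn => an; rewrite -leqNgt.
apply: leq_bigmax_seq => //.
by have : [set n | a n != 0] n by []; rewrite sE.
Qed.

Definition truncate N x n : R[i] := if (n <= N)%N then (x n)%:C else 0.

Lemma truncate_eq0 N x n : (N < n)%N -> truncate N x n = 0.
Proof. by rewrite /truncate ltnNge => /negbTE ->. Qed.

Lemma finitely_supported_truncate N x : finitely_supported (truncate N x).
Proof.
apply: (@sub_finite_set _ _ `I_N.+1) => [n /=|]; last exact: finite_II.
by apply: contraR; rewrite -leqNgt => /truncate_eq0 ->.
Qed.

End FiniteComplexSums.

Section DirichletEmbedding.
Context {R : realType}.
Variables (nu : {finite_measure set R -> \bar R}) (d : nat -> R).
Hypothesis d_gt0 : forall n, (1 <= n)%N -> 0 < d n.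
Local Notation rho := (fun n => (varrho d nu n)%:C).
Implicit Types (a b : nat -> R[i]) (x y : nat -> R) (N : nat).

Definition l2sqsum x N : R := \sum_(0 <= n < N) x n.+1 ^+ 2 / d n.+1.

(* Nonnegative coefficients suffice: on the real line the polynomial with
   coefficients [a n] is dominated by the one with coefficients [cabs (a n)]. *)
Definition dirichlet_embedding (C : R) : Prop := forall N x,
  (forall n, (1 <= n)%N -> 0 <= x n) ->
  \int[nu]_(s in D) (dirichlet_poly x N s ^+ 2) <= C * l2sqsum x N.

Let dS_gt0 n : 0 < d n.+1. Proof. exact: d_gt0. Qed.

Lemma l2sqsum_ge0 x N : 0 <= l2sqsum x N.
Proof. by apply: sumr_ge0 => n _; rewrite divr_ge0 ?sqr_ge0 // ltW. Qed.

Lemma hankel_form_finite a b N :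
  (forall n, (N < n)%N -> a n = 0) -> (forall n, (N < n)%N -> b n = 0) ->
  hankel_form rho d a b =
  \sum_(0 <= m < N) \sum_(0 <= n < N)
     a m.+1 * b n.+1 * (moment nu (m.+1 * n.+1))%:C.
Proof.
move=> a0 b0; rewrite /hankel_form (@fsbig_positive_nat _ _ N); last first.
  by move=> m /a0 ->; rewrite fsbig1 // => n _; rewrite !mul0r.
apply: eq_bigr => m _; rewrite (@fsbig_positive_nat _ _ N); last first.
  by move=> n /b0 ->; rewrite mulr0 mul0r.
apply: eq_bigr => n _; congr (_ * _); rewrite -[RHS]mulr1.
have dmn : (d (m.+1 * n.+1)%N)%:C != 0 :> R[i].
  by rewrite (inj_eq (@complexI R)) gt_eqF // d_gt0.
by rewrite /varrho rmorphM /= mulrAC divff // mul1r mulr1.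
Qed.

Lemma l2norm_finite a N : (forall n, (N < n)%N -> a n = 0) ->
  l2norm d a = Num.sqrt (l2sqsum (fun n => cabs (a n)) N).
Proof.
move=> a0; congr Num.sqrt.
rewrite (_ : (\sum_(1 <= n <oo) _)%E =
  (l2sqsum (fun n => cabs (a n)) N)%:E) //.
apply: cvg_lim => //; apply: cvg_near_cst; exists N.+1 => // k /= Nk.
rewrite (@big_cat_nat _ _ _ N.+1) //= [X in (_ + X)%E](_ : _ = 0%E).
  by rewrite adde0 big_add1 /= sumEFin.
rewrite big_nat_cond big1 // => i /andP[/andP[Ni _] _].
by rewrite a0 // ComplexField.Normc.normc0 expr0n mul0r.
Qed.

Lemma hankel_form_truncate N x y :
  hankel_form rho d (truncate N x) (truncate N y) =
  (\int[nu]_(s in D) (dirichlet_poly x N s * dirichlet_poly y N s))%:C.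
Proof.
rewrite (@hankel_form_finite _ _ N); [|exact: truncate_eq0|exact: truncate_eq0].
rewrite Rintegral_dirichlet_polyM rmorph_sum /=.
apply: eq_big_nat => m /andP[_ mN]; rewrite rmorph_sum /=.
apply: eq_big_nat => n /andP[_ nN].
by rewrite /truncate mN nN -!rmorphM.
Qed.

Lemma l2norm_truncate N x : l2norm d (truncate N x) = Num.sqrt (l2sqsum x N).
Proof.
rewrite (@l2norm_finite _ N); last exact: truncate_eq0.
congr Num.sqrt; apply: eq_big_nat => n /andP[_ nN].
by rewrite /truncate nN cabs_real real_normK ?num_real.
Qed.

Lemma cabs_hankel_form_le a b N :
  (forall n, (N < n)%N -> a n = 0) -> (forall n, (N < n)%N -> b n = 0) ->
  cabs (hankel_form rho d a b) <=
  \int[nu]_(s in D) (dirichlet_poly (fun n => cabs (a n)) N s *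
                     dirichlet_poly (fun n => cabs (b n)) N s).
Proof.
move=> a0 b0; rewrite (hankel_form_finite a0 b0) Rintegral_dirichlet_polyM.
apply: le_trans (ler_cabs_sum _ _) _; apply: ler_sum => m _.
apply: le_trans (ler_cabs_sum _ _) _; apply: ler_sum => n _.
by rewrite !ComplexField.Normc.normcM cabs_real ger0_norm ?moment_ge0.
Qed.

Lemma dirichlet_embedding_of_hankel_bounded :
  hankel_bounded rho d -> exists2 C, 0 < C & dirichlet_embedding C.
Proof.
move=> [C hankelC]; exists (`|C| + 1) => [|N x x0]; first by rewrite ltr_wpDl.
have := hankelC _ _ (finitely_supported_truncate N x)
                    (finitely_supported_truncate N x).
rewrite hankel_form_truncate !l2norm_truncate cabs_real -mulrA -expr2.
rewrite sqr_sqrtr ?l2sqsum_ge0 // => /(le_trans (ler_norm _))/le_trans; apply.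
by rewrite ler_wpM2r ?l2sqsum_ge0 // ler_wpDr // ler_norm.
Qed.

Lemma hankel_bounded_of_dirichlet_embedding C : 0 <= C ->
  dirichlet_embedding C -> hankel_bounded rho d.
Proof.
move=> C0 embC; exists C => a b /finitely_supported_bound[Na a0]
  /finitely_supported_bound[Nb b0]; pose N := maxn Na Nb.
have {}a0 n : (N < n)%N -> a n = 0 by rewrite gtn_max => /andP[/a0].
have {}b0 n : (N < n)%N -> b n = 0 by rewrite gtn_max => /andP[_ /b0].
apply: le_trans (cabs_hankel_form_le a0 b0) _.
have sqrt_emb c : Num.sqrt (\int[nu]_(s in D)
    (dirichlet_poly (fun n => cabs (c n)) N s ^+ 2)) <=
    Num.sqrt C * Num.sqrt (l2sqsum (fun n => cabs (c n)) N).
  by rewrite -sqrtrM //; apply/ler_wsqrtr/embC => n _; exact: cabs_ge0.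
apply: le_trans (ler_norm _) _.
apply: le_trans (Rintegral_cauchy_schwarz measurable_half_line
  (square_integrable_dirichlet_poly _ _ _)
  (square_integrable_dirichlet_poly _ _ _)) _.
apply: le_trans (ler_pM _ _ (sqrt_emb a) (sqrt_emb b)) _; rewrite ?sqrtr_ge0 //.
rewrite (l2norm_finite a0) (l2norm_finite b0) mulrACA -expr2 sqr_sqrtr //.
by rewrite mulrA.
Qed.

End DirichletEmbedding.

Definition half_line_growth (R : realType)
    (nu : {finite_measure set R -> \bar R}) (alpha C : R) : Prop :=
  power_growth nu D (fun s => s - 2^-1) alpha C.

Section HalfLineGrowth.
Context {R : realType} (nu : {finite_measure set R -> \bar R}).
Variable alpha : R.
Hypothesis alpha_gt0 : 0 < alpha.

Lemma half_line_sublevel (r : R) :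
  D `&` [set s | s - 2^-1 <= r] = `]2^-1, 2^-1 + r]%classic.
Proof.
apply/seteqP; split => s /=; rewrite half_lineE in_itv /= lerBlDl.
  by case=> -> ->.
by move=> /andP[].
Qed.

Definition capped_dist (s : R) : R := Num.min (s - 2^-1) 1.

Lemma capped_dist_gt0 s : D s -> 0 < capped_dist s.
Proof. by rewrite half_lineE lt_min ltr01 subr_gt0 => ->. Qed.

Lemma measurable_capped_dist : measurable_fun D capped_dist.
Proof. by apply: measurable_minr => //; exact: measurable_funB. Qed.

Lemma power_growth_capped_dist C :
  half_line_growth nu alpha C ->
  exists C', power_growth nu D capped_dist alpha C'.
Proof.
move=> growth; have C0 := power_growth_cst_ge0 growth.
exists (C + fine (nu D) / 1 `^ alpha).
apply: power_growth_of_small_radii => //; first exact: measurable_capped_dist.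
  exact: ltW.
move=> r r0 r1.
rewrite (_ : _ `&` _ = D `&` [set s | s - 2^-1 <= r]); first exact: growth.
by congr (_ `&` _); apply/funext => s /=; rewrite ge_min (leNgt 1) r1 orbF.
Qed.

End HalfLineGrowth.

Section ZetaTransform.
Context {R : realType} (nu : {finite_measure set R -> \bar R}) (alpha : R).
Hypothesis alpha_gt0 : 0 < alpha.
Implicit Types (u : R -> R) (s t : R).

Definition zeta_transform u t : R :=
  \int[nu]_(s in D) (zeta_powR alpha (s + t) * u s).

Lemma measurable_zeta_kernel :
  measurable_fun (D `*` D) (fun z => zeta_powR alpha (z.2 + z.1)).
Proof.
apply: (measurable_comp _ _ (measurable_zeta_powR alpha)).
- exact: measurable_itv.
- move=> _ [[t s] /= [Dt Ds] <-]; rewrite /= in_itv /= andbT.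
  exact: half_lineD_gt1.
- by apply: measurable_funTS; apply: measurable_funD.
Qed.

Lemma measurable_zeta_section t : D t ->
  measurable_fun D (fun s => zeta_powR alpha (s + t)).
Proof.
by move=> Dt; exact: measurable_pair1_setX Dt measurable_zeta_kernel.
Qed.

Lemma measurable_zeta_transform u : measurable_fun D u ->
  measurable_fun D (zeta_transform u).
Proof.
move=> mfu; apply: measurableT_comp => //.
exact: (measurable_kernel_integral nu _ _ measurable_zeta_kernel mfu).
Qed.

Lemma zeta_powR_le_capped_dist s t : D s -> D t ->
  zeta_powR alpha (s + t) <=
  3 `^ alpha * (capped_dist s + capped_dist t) `^ (- alpha).
Proof.
move=> Ds Dt; set x := _ + capped_dist t.
have x0 : 0 < x by rewrite addr_gt0 ?capped_dist_gt0.
have e0 : 0 < s + t - 1 by rewrite subr_gt0 half_lineD_gt1.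
have x_le2 : x <= 2.
  by rewrite -[leRHS](natrD _ 1 1) lerD // ge_min lexx orbT.
have x_le : x <= s + t - 1.
  rewrite (_ : s + t - 1 = (s - 2^-1) + (t - 2^-1)); last by field.
  by rewrite lerD // ge_min lexx.
have -> : s + t = 1 + (s + t - 1) by rewrite subrKC.
apply: le_trans (zeta_powR_le (ltW alpha_gt0) e0) _.
rewrite powRN_inv ?(ltW x0) // -powRM ?invr_ge0 ?(ltW x0) //.
apply: ge0_ler_powR; first exact: ltW.
- by rewrite nnegrE addr_ge0 ?invr_ge0 ?(ltW e0).
- by rewrite nnegrE mulr_ge0 ?invr_ge0 ?(ltW x0).
have -> : 3 / x = 2 / x + x^-1 by field; rewrite gt_eqF.
by apply: lerD; [rewrite ler_pdivlMr // mul1r|rewrite lef_pV2].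
Qed.

Lemma integrable_zeta_kernel_mul u t : D t -> nu.-integrable D (EFin \o u) ->
  nu.-integrable D (EFin \o (fun s => zeta_powR alpha (s + t) * u s)).
Proof.
move=> Dt ui; have taut := capped_dist_gt0 Dt.
pose B := 3 `^ alpha * capped_dist t `^ (- alpha).
apply: le_integrable (integrable_EFinZl measurable_half_line B ui) => //.
  apply/measurable_EFinP/measurable_funM.
    exact: measurable_zeta_section.
  exact/measurable_EFinP/measurable_int/ui.
move=> s Ds; rewrite /= lee_fin !normrM ler_wpM2r // !ger0_norm ?powR_ge0 //.
apply: le_trans (zeta_powR_le_capped_dist Ds Dt) _.
rewrite ler_wpM2l ?powR_ge0 // ge0_ger_powRN ?(ltW alpha_gt0) //.
by rewrite lerDr ltW ?capped_dist_gt0.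
Qed.

Definition zeta_schur_weight s : R := capped_dist s `^ (- (alpha / 2)).

Lemma measurable_zeta_schur_weight : measurable_fun D zeta_schur_weight.
Proof. exact: measurableT_comp (measurable_powR _) measurable_capped_dist. Qed.

Lemma integral_zeta_kernel_le C :
  half_line_growth nu alpha C ->
  exists2 A : R, 0 <= A & forall t, D t ->
  (\int[nu]_(s in D) (zeta_powR alpha (s + t) * zeta_schur_weight s)%:E <=
   (A * zeta_schur_weight t)%:E)%E.
Proof.
move=> /power_growth_capped_dist[] // C' growth.
have b0 : 0 < alpha / 2 by rewrite divr_gt0.
have b_lt : alpha / 2 < alpha by rewrite ltr_pdivrMr // ltr_pMr // ltr1n.
have [K K0 kernelK] := integral_homogeneous_kernel
  measurable_half_line measurable_capped_dist capped_dist_gt0 growth b0 b_lt.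
exists (3 `^ alpha * K) => [|t Dt]; first by rewrite mulr_ge0 ?powR_ge0.
apply: (@le_trans _ _ ((3 `^ alpha)%:E * \int[nu]_(s in D)
    ((capped_dist s + capped_dist t) `^ (- alpha) * zeta_schur_weight s)%:E)%E).
  have mzeta := measurable_zeta_section Dt.
  apply: ge0_le_integralZl => //.
  - exact: measurable_funM measurable_zeta_schur_weight.
  - apply: measurable_funM measurable_zeta_schur_weight.
    apply: measurableT_comp (measurable_powR _) _.
    by apply: measurable_funD => //; exact: measurable_capped_dist.
  - by move=> s _; rewrite mulr_ge0 ?powR_ge0.
  - by move=> s _; rewrite mulr_ge0 ?powR_ge0.
  - move=> s Ds; rewrite mulrA ler_wpM2r ?powR_ge0 //.
    exact: zeta_powR_le_capped_dist.
rewrite -mulrA EFinM lee_wpmul2l ?lee_fin ?powR_ge0 // kernelK //.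
exact: capped_dist_gt0.
Qed.

Lemma zeta_transform_sqr_le_abs u t : measurable_fun D u -> D t ->
  ((zeta_transform u t ^+ 2)%:E <=
   (\int[nu]_(s in D) (zeta_powR alpha (s + t) * `|u s|)%:E) ^+ 2)%E.
Proof.
move=> mfu Dt.
have fine_sqr_le (x : \bar R) : ((fine x ^+ 2)%:E <= `|x| ^+ 2)%E.
  have [/fineK <-|] := boolP (x \is a fin_num).
    by rewrite abse_EFin -EFin_expe lee_fin real_normK ?num_real.
  rewrite fin_numE => /nandP[] /negbNE/eqP ->;
    by rewrite [fine _]/= expr0n sqre_ge0.
apply: le_trans (fine_sqr_le _) _; rewrite lee_sqr ?integral_ge0 //; last first.
  by move=> s _; rewrite lee_fin mulr_ge0 ?powR_ge0.
have mzu : measurable_fun D (fun s => zeta_powR alpha (s + t) * u s).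
  apply: measurable_funM => //.
  exact: measurable_zeta_section.
apply: le_trans (le_abse_integral nu measurable_half_line _) _.
  exact/measurable_EFinP.
by under eq_integral do rewrite abse_EFin normrM ger0_norm ?powR_ge0 //.
Qed.

Lemma integral_zeta_transform_sqr_le C :
  half_line_growth nu alpha C ->
  exists2 A : R, 0 <= A & forall u, measurable_fun D u ->
  (\int[nu]_(t in D) (zeta_transform u t ^+ 2)%:E <=
   A%:E * \int[nu]_(s in D) (u s ^+ 2)%:E)%E.
Proof.
move=> /integral_zeta_kernel_le[A A0 row].
exists (A * A) => [|u mfu]; first exact: mulr_ge0.
have col t : D t -> (\int[nu]_(s in D)
    (zeta_powR alpha (t + s) * zeta_schur_weight s)%:E <=
    (A * zeta_schur_weight t)%:E)%E.
  by move=> Dt; under eq_integral do rewrite (addrC t); exact: row.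
have mq := measurable_zeta_schur_weight.
have q0 s : D s -> 0 < zeta_schur_weight s.
  by move=> Ds; rewrite powR_gt0 ?capped_dist_gt0.
apply: le_trans (schur_test (mu1 := nu) _ _ measurable_zeta_kernel _ mq mq _ q0
  A0 A0 row col mfu) => //.
- apply: ge0_le_integral => //.
  + by move=> t _; rewrite lee_fin sqr_ge0.
  + by apply/measurable_EFinP/measurable_funX; exact: measurable_zeta_transform.
  + under eq_fun do rewrite expe2.
    apply: emeasurable_funM;
      apply: (measurable_kernel_integral (u := fun s => `|u s|) nu _ _
        measurable_zeta_kernel) => //; exact: measurableT_comp.
  + by move=> t Dt; exact: zeta_transform_sqr_le_abs.
- by move=> x y _ _; exact: powR_ge0.
- by move=> s /q0/ltW.
Qed.

End ZetaTransform.

Local Notation I e := (`]2^-1, 2^-1 + e]%classic).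

Section GrowthNearHalf.
Context {R : realType} (nu : {finite_measure set R -> \bar R}) (alpha : R).
Hypothesis alpha_gt0 : 0 < alpha.
Implicit Types (C e r : R) (f : R -> R).

Lemma half_line_growth_of_near C : 0 < C ->
  (\forall e \near 0^'+, (nu (I e) <= (C * e `^ alpha)%:E)%E) ->
  exists C', half_line_growth nu alpha C'.
Proof.
move=> C0 [r0 /= r00 small]; exists (C + fine (nu D) / r0 `^ alpha).
apply: power_growth_of_small_radii => //; try exact: ltW.
  exact: measurable_funB.
move=> r r_gt0 rr0; rewrite half_line_sublevel; apply: small => //=.
by rewrite sub0r normrN gtr0_norm.
Qed.

Lemma near_growth_of_small_radii C r : 0 < r ->
  (forall e, 0 < e -> e < r -> fine (nu (I e)) <= C * e `^ alpha) ->
  \forall e \near 0^'+, (nu (I e) <= (C * e `^ alpha)%:E)%E.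
Proof.
move=> r0 growth; near=> e.
have e0 : 0 < e by near: e; exact: nbhs_right_gt.
have er : e < r by near: e; exact: nbhs_right_lt.
rewrite -[leLHS]fineK ?lee_fin; first exact: growth.
by rewrite fin_num_measure //; exact: measurable_itv.
Unshelve. all: by end_near. Qed.

Lemma measure_near_half_mul_le f e c : nu.-integrable D (EFin \o f) ->
  (forall s, D s -> 0 <= f s) -> (forall s, I e s -> c <= f s) ->
  fine (nu (I e)) * c <= \int[nu]_(s in D) f s.
Proof.
move=> fi f0 cf; apply: measure_mul_le_Rintegral => //.
- by move=> s /=; rewrite half_lineE in_itv /= => /andP[].
- by rewrite -ge0_fin_numE // fin_num_measure //; exact: measurable_itv.
Qed.

End GrowthNearHalf.

Section EmbeddingToGrowth.
Context {R : realType} (nu : {finite_measure set R -> \bar R}).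
Variables (alpha : R) (d : nat -> R).
Hypothesis alpha_gt0 : 0 < alpha.
Hypothesis hd : zeta_power_coeffs alpha d.

Lemma measure_near_half_le_dirichlet_embedding C e N :
  dirichlet_embedding nu d C -> 0 <= C -> 0 < e ->
  fine (nu (I e)) * dirichlet_poly d N (1 + 2 * e) <= C.
Proof.
move=> embC C0 e0; pose sigma := 2^-1 + e.
pose x n : R := d n * n%:R `^ (- sigma).
have d0 n : (1 <= n)%N -> 0 <= d n by move=> /hd.1/ltW.
have x0 n : (1 <= n)%N -> 0 <= x n by move=> n1; rewrite mulr_ge0 ?d0 ?powR_ge0.
pose S := dirichlet_poly d N (1 + 2 * e); rewrite -/S.
have xS : dirichlet_poly x N sigma = S.
  by rewrite -dirichlet_polyD /S; congr dirichlet_poly; rewrite /sigma; field.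
have xxS : l2sqsum d x N = S.
  rewrite -xS; apply: eq_bigr => n _; rewrite /x.
  by field; rewrite gt_eqF ?hd.1.
have S0 : 0 <= S by exact: dirichlet_poly_ge0.
have mass_S2 : fine (nu (I e)) * S ^+ 2 <= C * S.
  rewrite -{2}xxS; apply: le_trans (embC N x x0).
  apply: measure_near_half_mul_le.
  - exact: integrable_dirichlet_poly_sqr.
  - by move=> s _; rewrite sqr_ge0.
  - move=> s /=; rewrite in_itv /= => /andP[_ se].
    by rewrite -xS ler_sqr ?nnegrE ?dirichlet_poly_ge0 // ler_dirichlet_poly.
move: S0; rewrite le_eqVlt => /predU1P[<-|Spos]; first by rewrite mulr0.
by rewrite -(ler_pM2r Spos) -mulrA -expr2.
Qed.

Lemma growth_of_dirichlet_embedding C : 0 < C -> dirichlet_embedding nu d C ->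
  forall e, 0 < e -> fine (nu (I e)) <= C * 2 `^ alpha * e `^ alpha.
Proof.
move=> C0 embC e e0; have e20 : 0 < 2 * e by rewrite mulr_gt0.
have mass_zeta : fine (nu (I e)) * zeta_powR alpha (1 + 2 * e) <= C.
  have cvgP : fine (nu (I e)) * dirichlet_poly d N (1 + 2 * e) @[N --> \oo] -->
      fine (nu (I e)) * zeta_powR alpha (1 + 2 * e).
    by apply: cvgMl_tmp; apply: dirichlet_poly_cvg_zeta_powR; rewrite ?ltrDl.
  apply: ler_cvg_to cvgP (cvg_cst _) _; apply: nearW => N.
  by apply: measure_near_half_le_dirichlet_embedding => //; exact: ltW.
rewrite -mulrA -powRM ?(ltW e0) // -ler_pdivrMr ?powR_gt0 // -powRN.
apply: le_trans mass_zeta; rewrite ler_wpM2l ?fine_ge0 //.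
exact: zeta_powR_ge (ltW alpha_gt0) e20.
Qed.

End EmbeddingToGrowth.

Section MomentDecay.
Context {R : realType} (nu : {finite_measure set R -> \bar R}) (alpha : R).
Hypothesis alpha_gt0 : 0 < alpha.

Definition moment_decay (C : R) : Prop := forall n, (2 <= n)%N ->
  moment nu n <= C / (Num.sqrt n%:R * (ln n%:R) `^ alpha).

Lemma moment_decay_varrho (d : nat -> R) (C : R) :
  (forall n, (1 <= n)%N -> 0 < d n) ->
  moment_decay C <-> forall n, (2 <= n)%N ->
    varrho d nu n <= C * (d n / (Num.sqrt n%:R * (ln n%:R) `^ alpha)).
Proof.
move=> d_gt0.
have varrho_le n : (2 <= n)%N ->
    (varrho d nu n <= C * (d n / (Num.sqrt n%:R * (ln n%:R) `^ alpha))) =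
    (moment nu n <= C / (Num.sqrt n%:R * (ln n%:R) `^ alpha)).
  by move=> n2; rewrite /varrho mulrCA ler_pM2l // d_gt0 // ltnW.
by split=> decay n n2; have := decay n n2; rewrite varrho_le.
Qed.

Lemma natpowN_expR n (s : R) : (1 <= n)%N -> n%:R `^ (- s) =
  (Num.sqrt n%:R)^-1 * expR (- (ln n%:R * (s - 2^-1))).
Proof.
move=> n1; have n0 : 0 < n%:R :> R by rewrite ltr0n.
rewrite -powR12_sqrt ?ltW // -powRN /powR gt_eqF // -expRD.
by congr expR; ring.
Qed.

Lemma moment_decay_of_growth C : half_line_growth nu alpha C ->
  exists2 C' : R, 0 < C' & moment_decay C'.
Proof.
move=> growth.
have tau0 (s : R) : D s -> 0 < s - 2^-1 by rewrite half_lineE subr_gt0.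
have mtau : measurable_fun D (fun s : R => s - 2^-1) by exact: measurable_funB.
have [K K0 laplaceK] :=
  integral_expRN measurable_half_line mtau tau0 growth alpha_gt0.
exists (K + 1) => [|n n2]; first by rewrite ltr_wpDl.
have L0 : 0 < ln n%:R :> R by rewrite ln_gt0 // ltr1n.
have laplace_lty := le_lt_trans (laplaceK _ L0) (ltry _).
have laplace_le : \int[nu]_(s in D) expR (- (ln n%:R * (s - 2^-1))) <=
    (K + 1) * (ln n%:R) `^ (- alpha).
  rewrite -lee_fin fineK.
    apply: le_trans (laplaceK _ L0) _.
    by rewrite lee_fin ler_wpM2r ?powR_ge0 // lerDl.
  rewrite ge0_fin_numE //.
  by apply: integral_ge0 => s _; rewrite lee_fin expR_ge0.
rewrite /moment; under eq_Rintegral do rewrite natpowN_expR ?(ltnW n2) //.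
rewrite RintegralZl //; last first.
  apply/integrableP; split.
    apply/measurable_EFinP; apply: measurableT_comp.
      exact: measurable_expR.
    by apply: measurableT_comp => //; exact: measurable_funM.
  by under eq_integral do rewrite /= ger0_norm ?expR_ge0 //.
by rewrite invfM mulrCA -powRN ler_wpM2l // invr_ge0 sqrtr_ge0.
Qed.

Lemma growth_of_moment_decay C : 0 < C -> moment_decay C ->
  forall e : R, 0 < e -> e < 1 ->
    fine (nu (I e)) <= C * expR 1 * 2 `^ alpha * e `^ alpha.
Proof.
move=> C0 decay e e0 e1.
have [n [n2 npow_le ln_ge]] := exists_nat_near_expR_inv e0 e1.
have n0 : 0 < n%:R :> R by rewrite ltr0n ltnW.
have e20 : 0 < 2 * e by rewrite mulr_gt0.
have lnpow_le : (ln n%:R) `^ (- alpha) <= (2 * e) `^ alpha :> R.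
  rewrite -[2 * e]invrK -powRN_inv ?invr_ge0 ?(ltW e20) //.
  by rewrite ge0_ger_powRN ?(ltW alpha_gt0) ?invr_gt0.
have mass_le : fine (nu (I e)) * n%:R `^ (- (2^-1 + e)) <= moment nu n.
  rewrite -(prednK (ltnW n2)); apply: measure_near_half_mul_le.
  - exact: integrable_natpowN.
  - by move=> s _; exact: powR_ge0.
  - move=> s /=; rewrite in_itv /= => /andP[_ se].
    by apply: ler_powR; rewrite ?ler1n // lerN2.
move: (le_trans mass_le (decay n n2)).
rewrite opprD gt0_powRD // [n%:R `^ (- 2^-1)]powRN powR12_sqrt ?(ltW n0) //.
rewrite invfM mulrCA [leRHS]mulrCA ler_pM2l ?invr_gt0 ?sqrtr_gt0 //.
rewrite powRN ler_pdivrMr ?powR_gt0 // -powRN => /le_trans; apply.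
rewrite -[leRHS]mulrA -powRM ?(ltW e0) // -!mulrA ler_pM2l // mulrC.
by apply: ler_pM => //; exact: powR_ge0.
Qed.

End MomentDecay.

Section L2Operator.
Context {R : realType} (nu : {finite_measure set R -> \bar R}) (alpha : R).
Hypothesis alpha_gt0 : 0 < alpha.
Implicit Types (f : R -> R[i]) (z : R[i]).

Lemma cabs_sqr z : cabs z ^+ 2 = complex.Re z ^+ 2 + complex.Im z ^+ 2.
Proof. by case: z => x y /=; rewrite sqr_sqrtr // addr_ge0 ?sqr_ge0. Qed.

Lemma Re_real_mul (x : R) z : complex.Re (x%:C * z) = x * complex.Re z.
Proof. by case: z => y w /=; rewrite mul0r subr0. Qed.

Lemma Im_real_mul (x : R) z : complex.Im (x%:C * z) = x * complex.Im z.
Proof. by case: z => y w /=; rewrite mul0r addr0. Qed.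

Lemma Re_Kop f t : complex.Re (Kop alpha nu f t) =
  zeta_transform nu alpha (fun s => complex.Re (f s)) t.
Proof. by apply: eq_Rintegral => s _; rewrite Re_real_mul. Qed.

Lemma Im_Kop f t : complex.Im (Kop alpha nu f t) =
  zeta_transform nu alpha (fun s => complex.Im (f s)) t.
Proof. by apply: eq_Rintegral => s _; rewrite Im_real_mul. Qed.

Lemma L2sqnorm_ge0 f : (0 <= L2sqnorm nu f)%E.
Proof. exact: integral_sqr_ge0. Qed.

Lemma L2sqnormE f :
  measurable_fun D (fun s => complex.Re (f s)) ->
  measurable_fun D (fun s => complex.Im (f s)) ->
  L2sqnorm nu f = (\int[nu]_(s in D) (complex.Re (f s) ^+ 2)%:E
                   + \int[nu]_(s in D) (complex.Im (f s) ^+ 2)%:E)%E.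
Proof.
move=> mr mi; rewrite /L2sqnorm; under eq_integral do rewrite cabs_sqr EFinD.
rewrite ge0_integralD //; try by move=> s _; rewrite lee_fin sqr_ge0.
all: exact/measurable_EFinP/measurable_funX.
Qed.

Lemma L2_bounded_of_growth C :
  half_line_growth nu alpha C -> L2_bounded nu (Kop alpha nu).
Proof.
move=> /(integral_zeta_transform_sqr_le alpha_gt0)[A A0 zetaA].
exists (Num.sqrt A) => f [mr mi f_fin].
have mKr : measurable_fun D (fun t => complex.Re (Kop alpha nu f t)).
  by under eq_fun do rewrite Re_Kop; exact: measurable_zeta_transform.
have mKi : measurable_fun D (fun t => complex.Im (Kop alpha nu f t)).
  by under eq_fun do rewrite Im_Kop; exact: measurable_zeta_transform.
have Kf_le : (L2sqnorm nu (Kop alpha nu f) <= A%:E * L2sqnorm nu f)%E.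
  rewrite !L2sqnormE // ge0_muleDr ?integral_sqr_ge0 //; apply: leeD.
  - by under eq_integral do rewrite Re_Kop; exact: zetaA.
  - by under eq_integral do rewrite Im_Kop; exact: zetaA.
have fE : L2sqnorm nu f = (fine (L2sqnorm nu f))%:E.
  by rewrite fineK // ge0_fin_numE ?L2sqnorm_ge0.
have Kf_fin : (L2sqnorm nu (Kop alpha nu f) < +oo)%E.
  by apply: le_lt_trans Kf_le _; rewrite fE -EFinM ltry.
split; first by split.
rewrite /L2norm -sqrtrM //; apply: ler_wsqrtr.
by rewrite -lee_fin EFinM -fE fineK // ge0_fin_numE ?L2sqnorm_ge0.
Qed.

Lemma zeta_transform_bounded_of_L2_bounded :
  L2_bounded nu (Kop alpha nu) ->
  exists C : R, forall u, square_integrable nu D u ->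
    square_integrable nu D (zeta_transform nu alpha u) /\
    Num.sqrt (\int[nu]_(t in D) (zeta_transform nu alpha u t ^+ 2)) <=
    C * Num.sqrt (\int[nu]_(s in D) (u s ^+ 2)).
Proof.
move=> [C boundC]; exists C => u [mfu u_fin].
pose f s : R[i] := (u s)%:C.
have fE : L2sqnorm nu f = (\int[nu]_(s in D) (u s ^+ 2)%:E)%E.
  by apply: eq_integral => s _; rewrite cabs_sqr /= expr0n addr0.
have f_L2 : inL2 nu f by split; rewrite ?fE.
have [[mKr mKi Kf_fin] Kf_le] := boundC f f_L2.
have KE : (fun t => complex.Re (Kop alpha nu f t)) = zeta_transform nu alpha u.
  by apply/funext => t; rewrite Re_Kop.
rewrite KE in mKr.
have ReK_le : (\int[nu]_(t in D) (zeta_transform nu alpha u t ^+ 2)%:E <=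
    L2sqnorm nu (Kop alpha nu f))%E.
  by rewrite L2sqnormE ?KE // -KE leeDl // integral_sqr_ge0.
have zeta_fin := le_lt_trans ReK_le Kf_fin; split; first by split.
rewrite /L2norm fE in Kf_le; apply: le_trans Kf_le; apply: ler_wsqrtr.
by apply: fine_le ReK_le; rewrite ge0_fin_numE ?L2sqnorm_ge0 ?integral_sqr_ge0.
Qed.

Lemma zeta_form_le_of_L2_bounded : L2_bounded nu (Kop alpha nu) ->
  exists2 C : R, 0 < C & forall u, square_integrable nu D u ->
    square_integrable nu D (zeta_transform nu alpha u) /\
    \int[nu]_(t in D) (zeta_transform nu alpha u t * u t) <=
    C * \int[nu]_(s in D) (u s ^+ 2).
Proof.
move=> /zeta_transform_bounded_of_L2_bounded[C boundC].
exists (`|C| + 1) => [|u u2]; first by rewrite ltr_wpDl.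
have [Ku2 Ku_le] := boundC u u2; split=> //.
have sqr_int_ge0 : 0 <= \int[nu]_(s in D) (u s ^+ 2).
  by apply: Rintegral_ge0 => s _; exact: sqr_ge0.
apply: le_trans (ler_norm _) _.
apply: le_trans (Rintegral_cauchy_schwarz measurable_half_line Ku2 u2) _.
apply: le_trans (ler_wpM2r (sqrtr_ge0 _) Ku_le) _.
by rewrite -mulrA -expr2 sqr_sqrtr // ler_wpM2r ?ler_wpDr ?ler_norm.
Qed.

End L2Operator.

Section Duality.
Context {R : realType} (nu : {finite_measure set R -> \bar R}).
Variables (alpha : R) (d : nat -> R).
Hypothesis alpha_gt0 : 0 < alpha.
Hypothesis hd : zeta_power_coeffs alpha d.
Implicit Types (u : R -> R) (x : nat -> R) (n N : nat).

Definition power_moment u n : R := \int[nu]_(s in D) (n%:R `^ (- s) * u s).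

Lemma dirichlet_poly_power_moment_le u N t :
  (forall s, D s -> 0 <= u s) -> nu.-integrable D (EFin \o u) -> D t ->
  dirichlet_poly (fun n => d n * power_moment u n) N t <=
  zeta_transform nu alpha u t.
Proof.
move=> u0 ui Dt.
have -> : dirichlet_poly (fun n => d n * power_moment u n) N t =
    \int[nu]_(s in D) (dirichlet_poly d N (s + t) * u s).
  under eq_Rintegral do rewrite dirichlet_polyD.
  rewrite Rintegral_dirichlet_poly_mul //; apply: eq_bigr => n _.
  by rewrite mulrAC.
apply: le_Rintegral => //.
- under [X in _ \o X]eq_fun do rewrite dirichlet_polyD.
  exact: integrable_dirichlet_poly_mul.
- exact: integrable_zeta_kernel_mul.
- move=> s Ds; rewrite ler_wpM2r ?u0 // dirichlet_poly_le_zeta_powR //.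
  exact: half_lineD_gt1.
Qed.

Lemma sum_power_moment_sqr_le u N : (forall s, D s -> 0 <= u s) ->
  square_integrable nu D u -> nu.-integrable D (EFin \o u) ->
  square_integrable nu D (zeta_transform nu alpha u) ->
  \sum_(0 <= n < N) d n.+1 * power_moment u n.+1 ^+ 2 <=
  \int[nu]_(t in D) (zeta_transform nu alpha u t * u t).
Proof.
move=> u0 u2 ui Ku2.
have -> : \sum_(0 <= n < N) d n.+1 * power_moment u n.+1 ^+ 2 =
    \int[nu]_(t in D)
      (dirichlet_poly (fun n => d n * power_moment u n) N t * u t).
  rewrite Rintegral_dirichlet_poly_mul //; apply: eq_bigr => n _.
  by rewrite expr2 mulrA.
apply: le_Rintegral => //.
- exact: integrable_dirichlet_poly_mul.
- exact: square_integrableM.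
- by move=> t Dt; rewrite ler_wpM2r ?u0 // dirichlet_poly_power_moment_le.
Qed.

Lemma dual_pairing_le x (c : nat -> R) (C : R) N : 0 < C ->
  \sum_(0 <= n < N) x n.+1 * c n.+1 <=
  (C * l2sqsum d x N +
   C^-1 * \sum_(0 <= n < N) d n.+1 * c n.+1 ^+ 2) / 2.
Proof.
move=> C0; rewrite !mulr_sumr -big_split mulr_suml /=.
apply: ler_sum => n _; have d0 := hd.1 n.+1 isT; rewrite -subr_ge0.
have -> : (C * (x n.+1 ^+ 2 / d n.+1) + C^-1 * (d n.+1 * c n.+1 ^+ 2)) / 2 -
    x n.+1 * c n.+1 = (C * x n.+1 - d n.+1 * c n.+1) ^+ 2 / (2 * C * d n.+1).
  by field; rewrite !gt_eqF.
by rewrite divr_ge0 ?sqr_ge0 // !mulr_ge0 // ltW.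
Qed.

Lemma dirichlet_embedding_of_L2_bounded : L2_bounded nu (Kop alpha nu) ->
  exists2 C : R, 0 < C & dirichlet_embedding nu d C.
Proof.
move=> /zeta_form_le_of_L2_bounded[C C0 formC]; exists C => // N x x0.
set F := dirichlet_poly x N.
have F0 (s : R) : D s -> 0 <= F s by move=> _; exact: dirichlet_poly_ge0.
have F_int : nu.-integrable D (EFin \o F) by exact: integrable_dirichlet_poly.
have F2 : square_integrable nu D F by exact: square_integrable_dirichlet_poly.
have [KF2 form_le] := formC F F2.
have FE : \int[nu]_(s in D) (F s ^+ 2) =
    \sum_(0 <= n < N) x n.+1 * power_moment F n.+1.
  exact: Rintegral_dirichlet_poly_mul.
have adjoint_le := le_trans (sum_power_moment_sqr_le N F0 F2 F_int KF2) form_le.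
have pairing_le := dual_pairing_le x (power_moment F) N C0.
rewrite -FE in pairing_le; move: adjoint_le; rewrite -ler_pdivrMl //.
by lra.
Qed.

End Duality.

Theorem theorem6p2 (R : realType) (alpha : R) (halpha : 1 < alpha)
    (d : nat -> R) (hd : zeta_power_coeffs alpha d)
    (nu : {finite_measure set R -> \bar R}) (hnu : measure_on_half_line nu) :
  [<-> hankel_bounded (fun n => (varrho d nu n)%:C) d;
       exists2 C : R, 0 < C &
         \forall e \near 0^'+,
           (nu (`]2^-1, 2^-1 + e]%classic)%R <= (C * e `^ alpha)%:E)%E;
       exists2 C : R, 0 < C &
         forall n : nat, (2 <= n)%N ->
           varrho d nu n
             <= C * (d n / (Num.sqrt n%:R * (ln n%:R) `^ alpha));
       L2_bounded nu (Kop alpha nu)].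
Proof.
have alpha0 : 0 < alpha := lt_trans ltr01 halpha.
have d0 n : (1 <= n)%N -> 0 < d n := hd.1 n.
tfae.
- move=> /(dirichlet_embedding_of_hankel_bounded d0)[C C0 embC].
  exists (C * 2 `^ alpha); first by rewrite mulr_gt0 ?powR_gt0.
  apply: near_growth_of_small_radii ltr01 _ => e e0 _.
  exact: (growth_of_dirichlet_embedding alpha0 hd C0 embC).
- move=> [C C0 /(half_line_growth_of_near alpha0 C0)[C' growth]].
  have [C'' C''0 decay] := moment_decay_of_growth alpha0 growth.
  by exists C'' => //; apply/(moment_decay_varrho _ _ _ d0).
- move=> [C C0 /(moment_decay_varrho _ _ _ d0) decay].
  have K0 : 0 < C * expR 1 * 2 `^ alpha.
    by rewrite !mulr_gt0 ?expR_gt0 ?powR_gt0.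
  have [C' growth] := half_line_growth_of_near alpha0 K0
    (near_growth_of_small_radii ltr01 (growth_of_moment_decay alpha0 C0 decay)).
  exact: (L2_bounded_of_growth alpha0 growth).
- move=> /(dirichlet_embedding_of_L2_bounded alpha0 hd)[C C0 embC].
  exact: (hankel_bounded_of_dirichlet_embedding d0 (ltW C0) embC).
Qed.
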